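(* Consider the following optimal control problem. Let $T>0$, let $U\subseteq\mathbb{R}^k$ be compact with $0\in U$, let $f:[0,T]\times\mathbb{R}^n\times U\to\mathbb{R}^n$ be continuous and continuously differentiable in its second and third arguments, let $x_0\in\mathbb{R}^n$, let $\mathcal U$ be the set of measurable functions $u:[0,T]\to U$, let $\phi:[0,T]\times\mathbb{R}^n\times U\to\mathbb{R}$ be differentiable in its second argument, and let $\psi:\mathbb{R}^n\to\mathbb{R}$ be differentiable. The cost of $u\in\mathcal U$ is $J[u]=\int_0^T\phi(t,x_u(t),u(t))\,dt+\psi(x_u(T))$, where $x_u$ solves $\dot x(t)=f(t,x(t),u(t))$, $x(0)=x_0$. Assume the problem is nonsingular, and for $u\in\mathcal U$ let $\lambda_u$ be the costate solving $\dot\lambda(t)=-D_xf(t,x_u(t),u(t))^\top\lambda(t)-\phi_x(t,x_u(t),u(t))$, $\lambda(T)=\psi_x(x_u(T))$. Let $H(t,x,\lambda,u)=\lambda^\top f(t,x,u)+\phi(t,x,u)$, and let $\mathrm{MSA}:\mathcal U\to\mathcal U$ be the operator with $\mathrm{MSA}(u)(t)\in\arg\min_{\tilde u\in U}H(t,x_u(t),\lambda_u(t),\tilde u)$ for all $t\in[0,T]$ (ties broken by a fixed rule). Let $X,\Lambda\subset\mathbb{R}^n$ be bounded sets such that $x_u(t)\in X$ and $\lambda_u(t)\in\Lambda$ for all $u\in\mathcal U$ and $t\in[0,T]$. Fix a norm $\|\cdot\|$ on $\mathbb{R}^n$ with dual norm $\|\cdot\|_\star$, and a norm $\|\cdot\|_U$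 on $\mathbb{R}^k$. Assume: (A1) there is $c>0$ such that for all $t\in[0,T]$ and $\tilde u\in U$, the map $x\mapsto f(t,x,\tilde u)$ has one-sided Lipschitz constant at most $-c$ with respect to $\|\cdot\|$; moreover the solution of $\dot x=f(t,x,0)$, $x(0)=x_0$, is bounded on $[0,T]$; (A2) for all $t\in[0,T]$ and $\tilde x\in\mathbb{R}^n$, the map $u\mapsto f(t,\tilde x,u)$ is Lipschitz from $(U,\|\cdot\|_U)$ to $(\mathbb{R}^n,\|\cdot\|)$ with constant $\ell_{f,u}$; (A3) for all $t\in[0,T]$, $\tilde x\in X$, $\tilde u\in U$, $\tilde\lambda\in\Lambda$: the map $x\mapsto D_xf(t,x,\tilde u)^\top\tilde\lambda$ is Lipschitz from $(\mathbb{R}^n,\|\cdot\|)$ to $(\mathbb{R}^n,\|\cdot\|_\star)$ with constant $\ell_{f_x,x}$, and the map $u\mapsto D_xf(t,\tilde x,u)^\top\tilde\lambda$ is Lipschitz from $(U,\|\cdot\|_U)$ to $(\mathbb{R}^n,\|\cdot\|_\star)$ with constant $\ell_{f_x,u}$; (A4) for all $t\in[0,T]$, $\tilde x\in X$, $\tilde u\in U$: $x\mapsto\phi_x(t,x,\tilde u)$ is Lipschitz from $(\mathbb{R}^n,\|\cdot\|)$ to $(\mathbb{R}^n,\|\cdot\|_\star)$ with constant $\ell_{\phi_x,x}$; $u\mapsto\phi_x(t,\tilde x,u)$ is Lipschitz from $(U,\|\cdot\|_U)$ to $(\mathbb{R}^n,\|\cdot\|_\star)$ with constant $\ell_{\phi_x,u}$;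 and $x\mapsto\psi_x(x)$ is Lipschitz from $(\mathbb{R}^n,\|\cdot\|)$ to $(\mathbb{R}^n,\|\cdot\|_\star)$ with constant $\ell_{\psi_x,x}$; (A5) there is a map $h:[0,T]\times X\times\Lambda\to U$ with $h(t,x,\lambda)\in\arg\min_{u\in U}H(t,x,\lambda,u)$ for all $(t,x,\lambda)$, with ties broken identically to the MSA operator (so $\mathrm{MSA}(u)(t)=h(t,x_u(t),\lambda_u(t))$), such that for all fixed $t$, $\tilde x\in X$, $\tilde\lambda\in\Lambda$, the map $x\mapsto h(t,x,\tilde\lambda)$ is Lipschitz from $(\mathbb{R}^n,\|\cdot\|)$ to $(\mathbb{R}^k,\|\cdot\|_U)$ with constant $\ell_{h,x}$, and $\lambda\mapsto h(t,\tilde x,\lambda)$ is Lipschitz from $(\mathbb{R}^n,\|\cdot\|_\star)$ to $(\mathbb{R}^k,\|\cdot\|_U)$ with constant $\ell_{h,\lambda}$. Equip $\mathcal U$ with the norm $\|u\|_{\mathcal U}=\sup_{t\in[0,T]}\|u(t)\|_U$, and set $\kappa=c^{-1}(1-e^{-cT})$, $b_1=\ell_{h,x}\ell_{f,u}+\ell_{h,\lambda}(\ell_{\psi_x,x}\ell_{f,u}+\ell_{\phi_x,u}+\ell_{f_x,u})$, $b_2=\ell_{h,\lambda}\ell_{f,u}(\ell_{\phi_x,x}+\ell_{f_x,x})$. Then: (i) the Lipschitz constant of $\mathrm{MSA}$ with respect to $\|\cdot\|_{\mathcal U}$ satisfies ${\rm Lip}(\mathrm{MSA})\le b_1\kappa+b_2\kappa^2$;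 (ii) if $b_1\kappa+b_2\kappa^2<1$, then $\mathrm{MSA}$ is a contraction, it has a unique fixed point $\hat u\in\mathcal U$, the iterates $u^{(i)}=\mathrm{MSA}^i(u^{(0)})$ converge to $\hat u$ from any $u^{(0)}\in\mathcal U$, and for all $t\in[0,T]$ and all $i$, $\|u^{(i)}(t)-\hat u(t)\|_U\le\frac{(b_1\kappa+b_2\kappa^2)^i}{1-b_1\kappa-b_2\kappa^2}\|u^{(1)}-u^{(0)}\|_{\mathcal U}$.
   Context: The dual norm is $\|z\|_\star=\sup_{\|y\|\le1}y^\top z$. For a matrix $A$, the induced norm is $\|A\|=\sup_{\|x\|=1}\|Ax\|$ and the logarithmic norm is $\mu(A)=\lim_{h\to0^+}(\|I_n+hA\|-1)/h$. For a continuously differentiable $F:\mathbb{R}^n\to\mathbb{R}^n$, its one-sided Lipschitz constant with respect to $\|\cdot\|$ is $\sup_{x\in\mathbb{R}^n}\mu(DF(x))$. A map between normed spaces is Lipschitz with constant $\ell$ if $\|T(x)-T(\bar x)\|\le\ell\|x-\bar x\|$ for all $x,\bar x$. ''Nonsingular'' means that the multiplier of the running cost in Pontryagin's minimum principle is normalized to $1$, i.e. the Hamiltonian and costate are as given above. State and costate solutions are assumed to exist on $[0,T]$. *)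

(* Defs.v *)
From HB Require Import structures.
From mathcomp Require Import all_boot all_order all_algebra.
From mathcomp Require Import all_classical all_reals all_analysis.
Set Implicit Arguments. Unset Strict Implicit. Unset Printing Implicit Defensive.
Import Order.TTheory GRing.Theory Num.Theory.
Import numFieldNormedType.Exports.
Local Open Scope classical_set_scope.
Local Open Scope ring_scope.

(* N is a norm on R^n (arbitrary, not necessarily the library's max-norm). *)
Definition is_norm {R : realType} {n : nat} (N : 'cV[R]_n -> R) : Prop :=
  [/\ forall x, 0 <= N x, forall x, N x = 0 -> x = 0,
      forall (a : R) x, N (a *: x) = `|a| * N x
    & forall x y, N (x + y) <= N x + N y].

Definition vdot {R : realType} {n : nat} (y z : 'cV[R]_n) : R :=
  (y^T *m z) ord0 ord0.

Definition dualnorm {R : realType} {n : nat} (N : 'cV[R]_n -> R)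
  (z : 'cV[R]_n) : R :=
  sup [set vdot y z | y in [set y | N y <= 1]].

Definition opnorm {R : realType} {n : nat} (N : 'cV[R]_n -> R)
  (A : 'M[R]_n) : R :=
  sup [set N (A *m x) | x in [set x | N x = 1]].

Definition lognorm {R : realType} {n : nat} (N : 'cV[R]_n -> R)
  (A : 'M[R]_n) : R :=
  lim ((fun h : R => (opnorm N (1%:M + h *: A) - 1) / h) @ 0^'+).

Definition jac {R : realType} {n m : nat} (F : 'cV[R]_n -> 'cV[R]_m)
  (x : 'cV[R]_n) : 'M[R]_(m, n) :=
  \matrix_(i, j) ('D_(delta_mx j ord0) F x) i ord0.

Definition grad {R : realType} {n : nat} (g : 'cV[R]_n -> R)
  (x : 'cV[R]_n) : 'cV[R]_n :=
  \col_i ('D_(delta_mx i ord0) g x).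

(* F has one-sided Lipschitz constant (= sup_x mu(DF(x))) at most L *)
Definition osl_le {R : realType} {n : nat} (N : 'cV[R]_n -> R)
  (F : 'cV[R]_n -> 'cV[R]_n) (L : R) : Prop :=
  forall x, lognorm N (jac F x) <= L.

Definition lip_with {R : realType} {A B : zmodType}
  (N1 : A -> R) (N2 : B -> R) (D : set A) (F : A -> B) (l : R) : Prop :=
  forall x y, D x -> D y -> N2 (F x - F y) <= l * N1 (x - y).

Definition vintegrable {R : realType} {n : nat} (F : R -> 'cV[R]_n)
  (a b : R) : Prop :=
  forall i, (@lebesgue_measure R).-integrable `[a, b] (fun s => (F s i ord0)%:E).

Definition vint {R : realType} {n : nat} (F : R -> 'cV[R]_n) (a b : R)
  : 'cV[R]_n :=
  \col_i Rintegral (@lebesgue_measure R) `[a, b] (fun s => F s i ord0).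

Definition admissible {R : realType} {k : nat} (U : set 'cV[R]_k) (T : R)
  (u : R -> 'cV[R]_k) : Prop :=
  (forall t, 0 <= t <= T -> U (u t)) /\
  (forall i, measurable_fun `[0, T] (fun t => u t i ord0)).

(* x solves x' = f(t,x,u(t)), x(0) = x0 on [0,T] (Caratheodory sense) *)
Definition is_state {R : realType} {n k : nat}
  (f : R -> 'cV[R]_n -> 'cV[R]_k -> 'cV[R]_n) (x0 : 'cV[R]_n) (T : R)
  (u : R -> 'cV[R]_k) (x : R -> 'cV[R]_n) : Prop :=
  vintegrable (fun s => f s (x s) (u s)) 0 T /\
  forall t, 0 <= t <= T -> x t = x0 + vint (fun s => f s (x s) (u s)) 0 t.

Definition is_costate {R : realType} {n k : nat}
  (f : R -> 'cV[R]_n -> 'cV[R]_k -> 'cV[R]_n)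
  (phi : R -> 'cV[R]_n -> 'cV[R]_k -> R) (psi : 'cV[R]_n -> R) (T : R)
  (u : R -> 'cV[R]_k) (x l : R -> 'cV[R]_n) : Prop :=
  let g := fun s => (jac (fun y => f s y (u s)) (x s))^T *m l s
                    + grad (fun y => phi s y (u s)) (x s) in
  vintegrable g 0 T /\
  forall t, 0 <= t <= T -> l t = grad psi (x T) + vint g t T.

(* Hamiltonian (nonsingular case) *)
Definition Ham {R : realType} {n k : nat}
  (f : R -> 'cV[R]_n -> 'cV[R]_k -> 'cV[R]_n)
  (phi : R -> 'cV[R]_n -> 'cV[R]_k -> R)
  (t : R) (x l : 'cV[R]_n) (u : 'cV[R]_k) : R :=
  vdot l (f t x u) + phi t x u.

Definition unorm {R : realType} {k : nat} (NU : 'cV[R]_k -> R) (T : R)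
  (u : R -> 'cV[R]_k) : R :=
  sup [set NU (u t) | t in `[0, T]].

Definition MSA {R : realType} {n k : nat}
  (h : R -> 'cV[R]_n -> 'cV[R]_n -> 'cV[R]_k)
  (xs lam : (R -> 'cV[R]_k) -> R -> 'cV[R]_n) (u : R -> 'cV[R]_k)
  : R -> 'cV[R]_k :=
  fun t => h t (xs u t) (lam u t).

(* Main.v *)
Require Import Defs.
From HB Require Import structures.
From mathcomp Require Import all_boot all_order all_algebra.
From mathcomp Require Import all_classical all_reals all_analysis.
From mathcomp Require Import measurable_realfun lra ring.
Import Order.TTheory GRing.Theory Num.Theory.
Import numFieldNormedType.Exports.
Local Open Scope classical_set_scope.
Local Open Scope ring_scope.

(* The difference of two states and the difference of two costates are
   controlled without differentiating them almost everywhere.  By compactness,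
   a logarithmic norm at most [-c] gives [|1 + h A| <= 1 + h (e - c)] for all
   small [h], uniformly over the Jacobians met along the trajectories.  Hence
   the norm [m] of the difference satisfies
   [m (t + h) <= (1 - c h) m t + h (b + e)], where [b] bounds the forcing term,
   and iterating gives [m t <= m 0 + b kappa].  For the states,
   [b = l_fu |u - v|] and [m 0 = 0]; for the costates, in reversed time and in
   the dual norm, [b] and [m 0] also involve the state difference.  The
   Lipschitz constants of the minimizer of the Hamiltonian then give that of
   MSA. *)

(** * Norms on column vectors *)

(** The controls are only measurable, so the right-hand side at time [t] says nothing about nearby
    times, and an arbitrary norm need not be differentiable. Each short step is therefore integrated
    with the difference frozen at its start, while [s] and [u s] still vary; this is why the
    logarithmic-norm bound must be uniform. For the states, a Hahn-Banach functional norming the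
    endpoint difference turns the vector integral into a scalar one. The slack [e] absorbs both the
    limit in the logarithmic norm and the freezing error. The constant [kappa] is the value at [T]
    of the solution of [y' = 1 - c y], [y 0 = 0]. The state difference, already carrying a factor
    [kappa], forces the costate equation, which produces the term in [kappa ^+ 2]. *)

Lemma is_norm0 {R : realType} {n} {N : 'cV[R]_n -> R} : is_norm N -> N 0 = 0.
Proof. by move=> [_ _ NZ _]; rewrite -(scale0r 0) NZ normr0 mul0r. Qed.

Lemma is_normN {R : realType} {n} {N : 'cV[R]_n -> R} x :
  is_norm N -> N (- x) = N x.
Proof. by move=> [_ _ NZ _]; rewrite -scaleN1r NZ normrN normr1 mul1r. Qed.

Lemma is_normB {R : realType} {n} {N : 'cV[R]_n -> R} x y :
  is_norm N -> N (x - y) = N (y - x).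
Proof. by move=> hN; rewrite -(is_normN _ hN) opprB. Qed.

Lemma is_norm_sum {R : realType} {n} {N : 'cV[R]_n -> R} {I : Type} (r : seq I)
    (F : I -> 'cV[R]_n) :
  is_norm N -> N (\sum_(i <- r) F i) <= \sum_(i <- r) N (F i).
Proof.
move=> hN; elim: r => [|i r IH]; first by rewrite !big_nil (is_norm0 hN).
rewrite !big_cons; case: hN => _ _ _ NT.
by apply: le_trans (NT _ _) _; rewrite lerD2l.
Qed.

Lemma cV_delta_sum {R : realType} {n} (x : 'cV[R]_n) :
  x = \sum_i x i ord0 *: delta_mx i ord0.
Proof.
by rewrite [LHS]matrix_sum_delta; apply: eq_bigr => i _; rewrite big_ord1.
Qed.

Lemma coord_le_mx_norm {R : realType} {m n} (x : 'M[R]_(m, n)) i j :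
  `|x i j| <= `|x|.
Proof.
rewrite [leRHS]/Num.norm /= mx_normrE; apply/bigmax_geP; right => /=.
by exists (i, j).
Qed.

Lemma mx_norm_le {R : realType} {m n} (x : 'M[R]_(m, n)) r :
  0 <= r -> (forall i j, `|x i j| <= r) -> `|x| <= r.
Proof.
by move=> r0 h; rewrite [leLHS]/Num.norm /= mx_normrE; apply/bigmax_leP; split.
Qed.

Lemma is_norm_le {R : realType} {n} {N : 'cV[R]_n -> R} : is_norm N ->
  exists2 C, 0 < C & forall x, N x <= C * `|x|.
Proof.
move=> hN; have [N0 _ NZ _] := hN.
pose S := \sum_i N (delta_mx i ord0).
have S0 : 0 <= S by apply: sumr_ge0 => i _; exact: N0.
exists (S + 1); first by rewrite ltr_wpDl.
move=> x; apply: (@le_trans _ _ (S * `|x|)); last first.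
  by rewrite ler_wpM2r// lerDl.
rewrite {1}[x]cV_delta_sum; apply: le_trans (is_norm_sum _ _ hN) _.
rewrite mulr_suml; apply: ler_sum => i _.
by rewrite NZ mulrC ler_wpM2l ?N0 ?coord_le_mx_norm.
Qed.

Lemma is_norm_continuous {R : realType} {n} {N : 'cV[R]_n -> R} :
  is_norm N -> continuous N.
Proof.
move=> hN x; have [C C0 NC] := is_norm_le hN; have [_ _ _ NT] := hN.
apply: (iffRL (@cvgrPdist_lt _ _ _ (nbhs x) _ N (N x))) => e e0; near=> y.
have h : `|N x - N y| <= N (x - y).
  rewrite ler_norml; apply/andP; split; last first.
    by rewrite lerBlDr -{1}(subrK y x).
  by rewrite lerNl opprB lerBlDr (is_normB _ _ hN) -{1}(subrK x y).
apply: le_lt_trans h _; apply: le_lt_trans (NC _) _.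
rewrite mulrC -ltr_pdivlMr//; near: y.
by apply: cvgr_dist_lt; [exact: cvg_id|rewrite divr_gt0].
Unshelve. all: by end_near. Qed.

Lemma mx_norm_trmx {R : realType} {m n} (x : 'M[R]_(m, n)) : `|x^T| <= `|x|.
Proof.
by apply: mx_norm_le => // i j; rewrite mxE; exact: coord_le_mx_norm.
Qed.

Lemma trmx_continuous {R : realType} {m n} :
  continuous (fun x : 'M[R]_(m, n) => x^T).
Proof.
move=> x; apply: (iffRL (@cvgrPdist_lt _ _ _ (nbhs x) _ trmx x^T)) => e e0;
  near=> y.
rewrite -linearB/=; apply: le_lt_trans (mx_norm_trmx _) _.
near: y.
by apply: cvgr_dist_lt; [exact: cvg_id|].
Unshelve. all: by end_near. Qed.

Lemma cV_bounded_closed_compact {R : realType} {n} (A : set 'cV[R]_n) :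
  bounded_set A -> closed A -> compact A.
Proof.
move=> bA cA.
(* Transposition carries Heine-Borel from row vectors to column vectors. *)
have -> : A = trmx @` (trmx @^-1` A : set 'rV[R]_n).
  apply/seteqP; split => [x Ax|_ [x Ax <-]]; last exact: Ax.
  by exists x^T; rewrite /= trmxK.
apply: continuous_compact.
  by apply: continuous_subspaceT => x; exact: trmx_continuous.
apply: bounded_closed_compact.
  have [M [Mr hM]] := bA; exists M; split => // r Mr' x /(hM r Mr').
  by apply: le_trans; rewrite -{1}(trmxK x); exact: mx_norm_trmx.
by apply: preimage_closed => // x _; exact: trmx_continuous.
Qed.

(** The image of the compact max-norm unit sphere under [N] is closed and misses 0, hence misses a
    ball of radius [e] about 0; the constant is [e^-1]. *)
Lemma mx_norm_le_is_norm {R : realType} {n} {N : 'cV[R]_n -> R} : is_norm N ->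
  exists2 C, 0 < C & forall x, `|x| <= C * N x.
Proof.
move=> hN; have [N0 Neq0 NZ _] := hN.
pose Sph := [set x : 'cV[R]_n | `|x| = 1].
have cS : compact Sph.
  apply: cV_bounded_closed_compact.
    by exists 1; split => // M M1 x /= ->; exact: ltW.
  rewrite (_ : Sph = Num.norm @^-1` [set 1])//.
  by apply: preimage_closed => // x _; exact: norm_continuous.
have cI : closed (N @` Sph).
  apply: compact_closed; first exact: Rhausdorff.
  apply: continuous_compact => //.
  by apply: continuous_subspaceT => x; exact: is_norm_continuous.
have n0 : ~ (N @` Sph) 0.
  move=> [x /= x1] /Neq0 x0; have := @normr0 _ 'cV[R]_n.
  by rewrite -x0 x1 => /eqP; rewrite oner_eq0.
have /nbhs_ballP[e /= e0 he] : nbhs (0 : R) (~` (N @` Sph)).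
  by apply: open_nbhs_nbhs; split => //; exact: closed_openC.
exists e^-1; first by rewrite invr_gt0.
move=> x; have [->|x0] := eqVneq x 0;
  first by rewrite normr0 (is_norm0 hN) mulr0.
have nx : 0 < `|x| by rewrite normr_gt0.
have : e <= N (`|x|^-1 *: x).
  rewrite leNgt; apply/negP => lt.
  apply: (he (N (`|x|^-1 *: x))).
    by rewrite /ball /= sub0r normrN ger0_norm.
  exists (`|x|^-1 *: x) => //=.
  rewrite /Sph /= normrZ normfV normr_id mulVf//.
  by rewrite gt_eqF.
rewrite NZ normfV normr_id [leRHS]mulrC ler_pdivlMr// => h.
by rewrite mulrC ler_pdivlMr// mulrC.
Qed.

Lemma vdotE {R : realType} {n} (y z : 'cV[R]_n) :
  vdot y z = \sum_i y i ord0 * z i ord0.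
Proof. by rewrite /vdot mxE; apply: eq_bigr => i _; rewrite mxE. Qed.

Lemma vdotC {R : realType} {n} (y z : 'cV[R]_n) : vdot y z = vdot z y.
Proof. by rewrite !vdotE; apply: eq_bigr => i _; rewrite mulrC. Qed.

Lemma vdotDr {R : realType} {n} (y z w : 'cV[R]_n) :
  vdot y (z + w) = vdot y z + vdot y w.
Proof. by rewrite /vdot mulmxDr mxE. Qed.

Lemma vdotZr {R : realType} {n} a (y z : 'cV[R]_n) :
  vdot y (a *: z) = a * vdot y z.
Proof. by rewrite /vdot -scalemxAr mxE. Qed.

Lemma vdotNr {R : realType} {n} (y z : 'cV[R]_n) : vdot y (- z) = - vdot y z.
Proof. by rewrite -scaleN1r vdotZr mulN1r. Qed.

Lemma vdotBr {R : realType} {n} (y z w : 'cV[R]_n) :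
  vdot y (z - w) = vdot y z - vdot y w.
Proof. by rewrite vdotDr vdotNr. Qed.

Lemma vdot0r {R : realType} {n} (y : 'cV[R]_n) : vdot y 0 = 0.
Proof. by rewrite -(scale0r 0) vdotZr mul0r. Qed.

Lemma vdot_trmx {R : realType} {n} (A : 'M[R]_n) (y z : 'cV[R]_n) :
  vdot y (A^T *m z) = vdot (A *m y) z.
Proof. by rewrite /vdot trmx_mul mulmxA. Qed.

Definition sublinear {R : realType} {n} (q : 'cV[R]_n -> R) :=
  (forall x y, q (x + y) <= q x + q y) /\
  (forall a x, 0 <= a -> q (a *: x) <= a * q x).

(* The sublinear function [inf_(t >= 0) q (x + t e) - t q e] is linear on the
   line spanned by [e]. *)
Lemma sublinear_linearize {R : realType} {n} (q : 'cV[R]_n -> R) e :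
  sublinear q -> exists q', [/\ sublinear q', forall x, q' x <= q x &
    q' (- e) <= - q e].
Proof.
move=> [qD qZ].
have q0 : q 0 = 0.
  apply/eqP; rewrite eq_le; apply/andP; split.
    by have := qZ 0 0 (lexx _); rewrite scale0r mul0r.
  by have := qD 0 0; rewrite addr0 lerDl.
pose S x := [set q (x + t *: e) - t * q e | t in [set t | 0 <= t]].
have Slb x : lbound (S x) (- q (- x)).
  move=> _ [t /= t0 <-]; rewrite lerBrDr addrC lerBlDr.
  apply: le_trans (qD _ _); rewrite addrAC subrr add0r.
  have [->|tn0] := eqVneq t 0; first by rewrite scale0r mul0r q0.
  (* Homogeneity is assumed only as an inequality; using it with the factor [t^-1] gives the
     converse [t * q e <= q (t *: e)]. *)
  have := qZ t^-1 (t *: e); rewrite invr_ge0 => /(_ t0).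
  by rewrite scalerA mulVf// scale1r mulrC ler_pdivlMr ?lt_def ?tn0// mulrC.
have hS x : has_inf (S x).
  split; last by exists (- q (- x)).
  by exists (q (x + 0 *: e) - 0 * q e), 0 => /=.
have le_q' x t : 0 <= t -> inf (S x) <= q (x + t *: e) - t * q e.
  by move=> t0; apply: ge_inf; [exact: (hS x).2|exists t].
exists (fun x => inf (S x)); split.
- split => [x y|a x a0].
    rewrite -lerBlDr; apply: lb_le_inf; first exact: (hS x).1.
    move=> _ [t /= t0 <-]; rewrite lerBlDr -lerBlDl.
    apply: lb_le_inf; first exact: (hS y).1.
    move=> _ [s /= s0 <-]; rewrite lerBlDl.
    apply: le_trans (le_q' (x + y) (t + s) (addr_ge0 t0 s0)) _.
    have -> : x + y + (t + s) *: e = (x + t *: e) + (y + s *: e).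
      by rewrite scalerDl addrACA.
    by have := qD (x + t *: e) (y + s *: e); lra.
  move: a0; rewrite le_eqVlt => /predU1P[<-|a0].
    rewrite scale0r mul0r; have := le_q' 0 0 (lexx _).
    by rewrite scale0r addr0 mul0r subr0 q0.
  rewrite mulrC -ler_pdivrMr//; apply: lb_le_inf; first exact: (hS x).1.
  move=> _ [t /= t0 <-]; rewrite ler_pdivrMr// mulrBl.
  apply: le_trans (le_q' (a *: x) (a * t) (mulr_ge0 (ltW a0) t0)) _.
  rewrite -scalerA -scalerDr; have := qZ a (x + t *: e) (ltW a0).
  by lra.
- by move=> x; have := le_q' x 0 (lexx _); rewrite scale0r addr0 mul0r subr0.
- have := le_q' (- e) 1 ler01.
  by rewrite scale1r addNr q0 mul1r sub0r.
Qed.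

(** Linearizing [N] along [z] and then along every basis vector replaces Zorn's lemma in finite
    dimension. The first linearization is what gives [N z <= vdot p z]: whatever lies below [q1] is
    at most [- N z] at [- z]. *)
Lemma hahn_banach_cV {R : realType} {n} {N : 'cV[R]_n -> R} (z : 'cV[R]_n) :
  is_norm N -> exists p, (forall y, vdot p y <= N y) /\ vdot p z = N z.
Proof.
move=> hN; have [N0 Neq0 NZ NT] := hN.
have sN : sublinear N by split => // a x a0; rewrite NZ ger0_norm.
have [q1 [sq1 q1N q1z]] := sublinear_linearize N z sN.
have [q [sq qq1 qe]] : exists q, [/\ sublinear q, forall x, q x <= q1 x &
    forall i : 'I_n, q (- delta_mx i ord0) <= - q (delta_mx i ord0)].
  (* Later linearizations only lower the functional, so [q' (- e) <= q (- e) <= - q e <= - q' e]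
     preserves the directions already treated. *)
  have : forall s : seq 'I_n, exists q, [/\ sublinear q, forall x, q x <= q1 x &
    forall i : 'I_n, i \in s -> q (- delta_mx i ord0) <= - q (delta_mx i ord0)].
    elim => [|i s [q [sq qq1 qs]]]; first by exists q1; split.
    have [q' [sq' q'q q'i]] := sublinear_linearize q (delta_mx i ord0) sq.
    exists q'; split => // [x|j]; first exact: le_trans (q'q _) _.
    rewrite inE => /predU1P[->|js].
      by apply: le_trans q'i _; rewrite lerN2.
    apply: le_trans (q'q _) _; apply: le_trans (qs j js) _.
    by rewrite lerN2.
  move=> /(_ (index_enum 'I_n)) [q [sq qq1 qs]]; exists q; split => // i.
  by apply: qs; rewrite mem_index_enum.
have [qD qZ] := sq.
pose p : 'cV[R]_n := \col_i q (delta_mx i ord0).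
(* Negative coordinates go through [q (- e) <= - q e]. This bound at [- y], with
   [0 <= q y + q (- y)], then yields the converse [vdot p y <= q y]. *)
have qp x : q x <= vdot p x.
  rewrite {1}[x]cV_delta_sum vdotE.
  have q0 : q 0 <= 0 by have := qZ 0 0 (lexx _); rewrite scale0r mul0r.
  have qs : q (\sum_i x i ord0 *: delta_mx i ord0) <=
            \sum_i q (x i ord0 *: delta_mx i ord0).
    elim/big_rec2: _ => // i y1 y2 _ h.
    by apply: le_trans (qD _ _) _; rewrite lerD2l.
  apply: le_trans qs _; apply: ler_sum => i _; rewrite mxE.
  have [x0|x0] := leP 0 (x i ord0); first by rewrite mulrC; exact: qZ.
  rewrite -[x i ord0]opprK scaleNr -scalerN.
  have x0' : 0 <= - x i ord0 by rewrite oppr_ge0 ltW.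
  apply: le_trans (qZ _ _ x0') _.
  by have := ler_wpM2l x0' (qe i); lra.
have pN y : vdot p y <= q y.
  have := qp (- y); rewrite vdotNr => h.
  have : q y + q (- y) >= 0.
    have := qD y (- y); rewrite subrr.
    have := qD 0 0; rewrite addr0; lra.
  by lra.
exists p; split => [y|].
  by apply: le_trans (pN y) _; exact: le_trans (qq1 _) _.
apply/eqP; rewrite eq_le; apply/andP; split.
  by apply: le_trans (pN z) _; exact: le_trans (qq1 _) _.
have := pN (- z); rewrite vdotNr => h.
have := qq1 (- z); lra.
Qed.

(** * Dual and logarithmic norms *)

Lemma is_norm_mulmx {R : realType} {n} {N : 'cV[R]_n -> R} : is_norm N ->
  exists2 C, 0 < C & forall A x, N (A *m x) <= C * `|A| * N x.
Proof.
move=> hN; have [C C0 NC] := is_norm_le hN.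
have [D D0 ND] := mx_norm_le_is_norm hN.
exists ((C * D) * (n%:R + 1)).
  by rewrite !mulr_gt0// ltr_wpDl.
move=> A x; have Nx : 0 <= N x by case: hN.
apply: le_trans (NC _) _.
have -> : C * D * (n%:R + 1) * `|A| * N x = C * ((n%:R + 1) * `|A| * (D * N x)).
  by ring.
rewrite ler_pM2l//; apply: mx_norm_le.
  by rewrite !mulr_ge0// ltW.
move=> i j; rewrite mxE; apply: le_trans (ler_norm_sum _ _ _) _.
apply: (@le_trans _ _ (\sum_(k < n) `|A| * (D * N x))).
  apply: ler_sum => k _; rewrite normrM; apply: ler_pM => //.
    exact: coord_le_mx_norm.
  exact: le_trans (coord_le_mx_norm _ _ _) (ND x).
rewrite sumr_const card_ord -[leLHS]mulr_natl -[leRHS]mulrA.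
by rewrite ler_wpM2r ?lerDl// !mulr_ge0// ltW.
Qed.

Lemma has_sup_dualnorm {R : realType} {n} {N : 'cV[R]_n -> R} z : is_norm N ->
  has_sup [set vdot y z | y in [set y | N y <= 1]].
Proof.
move=> hN; split; first by exists (vdot 0 z), 0 => //=; rewrite (is_norm0 hN).
have [D D0 ND] := mx_norm_le_is_norm hN.
exists (D * \sum_i `|z i ord0|) => _ [y /= y1 <-].
apply: le_trans (ler_norm _) _; rewrite vdotE.
apply: le_trans (ler_norm_sum _ _ _) _; rewrite mulr_sumr.
apply: ler_sum => i _; rewrite normrM ler_wpM2r//.
apply: le_trans (coord_le_mx_norm _ _ _) _; apply: le_trans (ND _) _.
by rewrite -[leRHS]mulr1 ler_wpM2l ?(ltW D0).
Qed.

Lemma vdotZl {R : realType} {n} a (y z : 'cV[R]_n) :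
  vdot (a *: y) z = a * vdot y z.
Proof. by rewrite vdotC vdotZr vdotC. Qed.

Lemma vdot_le_dualnorm {R : realType} {n} {N : 'cV[R]_n -> R} y z :
  is_norm N -> vdot y z <= N y * dualnorm N z.
Proof.
move=> hN; have [N0 Neq0 NZ _] := hN.
have [y0|y0] := eqVneq (N y) 0.
  by rewrite y0 mul0r (Neq0 _ y0) vdotC vdot0r.
have Ny : 0 < N y by rewrite lt_def y0 N0.
rewrite mulrC -ler_pdivrMr// mulrC -vdotZl.
apply: sup_upper_bound; first exact: has_sup_dualnorm.
exists ((N y)^-1 *: y) => //=.
by rewrite NZ ger0_norm ?invr_ge0 ?N0// mulVf.
Qed.

Lemma dualnorm_le {R : realType} {n} {N : 'cV[R]_n -> R} z r : is_norm N ->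
  (forall y, N y <= 1 -> vdot y z <= r) -> dualnorm N z <= r.
Proof.
move=> hN h; apply: ge_sup; first exact: (has_sup_dualnorm z hN).1.
by move=> _ [y /= y1 <-]; exact: h.
Qed.

Lemma dualnorm_ge0 {R : realType} {n} {N : 'cV[R]_n -> R} z : is_norm N ->
  0 <= dualnorm N z.
Proof.
move=> hN; apply: sup_upper_bound; first exact: has_sup_dualnorm.
by exists 0; rewrite /= ?(is_norm0 hN)// vdotC vdot0r.
Qed.

Lemma vdot_le_dualnorm1 {R : realType} {n} {N : 'cV[R]_n -> R} y z :
  is_norm N -> N y <= 1 -> vdot y z <= dualnorm N z.
Proof.
move=> hN y1; apply: le_trans (vdot_le_dualnorm y z hN) _.
by rewrite -[leRHS]mul1r ler_wpM2r// dualnorm_ge0.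
Qed.

Lemma dualnorm_le_mx_norm {R : realType} {n} {N : 'cV[R]_n -> R} : is_norm N ->
  exists2 C, 0 < C & forall z, dualnorm N z <= C * `|z|.
Proof.
move=> hN; have [D D0 ND] := mx_norm_le_is_norm hN.
exists (D * (n%:R + 1)); first by rewrite mulr_gt0// ltr_wpDl.
move=> z; apply: dualnorm_le => // y y1; apply: le_trans (ler_norm _) _.
rewrite vdotE; apply: le_trans (ler_norm_sum _ _ _) _.
apply: (@le_trans _ _ (\sum_(i < n) D * `|z|)).
  apply: ler_sum => i _; rewrite normrM; apply: ler_pM => //.
    apply: le_trans (coord_le_mx_norm _ _ _) _; apply: le_trans (ND _) _.
    by rewrite -[leRHS]mulr1 ler_wpM2l ?(ltW D0).
  exact: coord_le_mx_norm.
rewrite sumr_const card_ord -[leLHS]mulr_natl mulrCA -[leRHS]mulrA.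
by rewrite ler_wpM2l ?(ltW D0)// ler_wpM2r// lerDl.
Qed.

(** The unit vector excludes dimension 0, where the supremum of the empty set takes the default
    value 0, possibly above [r]. *)
Lemma opnorm_le {R : realType} {n} {N : 'cV[R]_n -> R} A r :
  (exists x, N x = 1) -> (forall x, N x = 1 -> N (A *m x) <= r) ->
  opnorm N A <= r.
Proof.
move=> [x x1] h; apply: ge_sup; first by exists (N (A *m x)), x.
by move=> _ [y /= y1 <-]; exact: h.
Qed.

Lemma le_opnorm {R : realType} {n} {N : 'cV[R]_n -> R} A x :
  is_norm N -> N (A *m x) <= opnorm N A * N x.
Proof.
move=> hN; have [N0 Neq0 NZ _] := hN.
have [x0|x0] := eqVneq (N x) 0.
  by rewrite x0 mulr0 (Neq0 _ x0) mulmx0 (is_norm0 hN).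
have Nx : 0 < N x by rewrite lt_def x0 N0.
rewrite -ler_pdivrMr// mulrC.
have -> : (N x)^-1 * N (A *m x) = N (A *m ((N x)^-1 *: x)).
  by rewrite -scalemxAr NZ ger0_norm// invr_ge0.
have e1 : N ((N x)^-1 *: x) = 1 by rewrite NZ ger0_norm ?invr_ge0 ?N0// mulVf.
apply: sup_upper_bound; last by exists ((N x)^-1 *: x).
split; first by exists (N (A *m ((N x)^-1 *: x))), ((N x)^-1 *: x).
have [C C0 NC] := is_norm_mulmx hN.
exists (C * `|A|) => _ [y /= y1 <-].
by apply: le_trans (NC _ _) _; rewrite y1 mulr1.
Qed.

(* Convexity of [h |-> `|1 + h A|] makes the difference quotient monotone, so
   the limit defining the logarithmic norm exists and is an infimum. *)
Lemma lognorm_lt_step {R : realType} {n} {N : 'cV[R]_n -> R} (A : 'M[R]_n) l :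
  is_norm N -> lognorm N A < l ->
  exists2 h, 0 < h & forall x, N (x + h *: (A *m x)) <= (1 + h * l) * N x.
Proof.
move=> hN; have [N0 Neq0 NZ NT] := hN.
(* If [N] vanishes identically there is no unit vector and [opnorm] is a default value, but the
   inequality is then trivial. *)
have [[x x0]|nx] := pselect (exists x, N x != 0); last first.
  move=> _; exists 1 => // x; suff Nz y : N y = 0 by rewrite !Nz mulr0.
  by apply/eqP; apply: contrapT => /negP yn; apply: nx; exists y.
have Nx : 0 < N x by rewrite lt_def x0 N0.
pose z := (N x)^-1 *: x.
have z1 : N z = 1 by rewrite NZ ger0_norm ?invr_ge0 ?N0// mulVf.
have ez : exists z, N z = 1 by exists z.
have [C C0 NC] := is_norm_mulmx hN.
pose g h := (opnorm N (1%:M + h *: A) - 1) / h.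
have actE h y : (1%:M + h *: A) *m y = y + h *: (A *m y).
  by rewrite mulmxDl mul1mx scalemxAl.
have ndg : {in `]0, 1[ &, nondecreasing_fun g}.
  move=> h k; rewrite !in_itv /= => /andP[h0 _] /andP[k0 _] hk.
  rewrite /g ler_pdivrMr// mulrAC ler_pdivlMr//.
  have {}hk : h / k <= 1 by rewrite ler_pdivrMr// mul1r.
  have hk0 : 0 <= h / k by rewrite divr_ge0// ltW.
  suff : opnorm N (1%:M + h *: A) <=
         (1 - h / k) + h / k * opnorm N (1%:M + k *: A).
    move=> /(ler_wpM2r (ltW k0)).
    have -> o : (1 - h / k + h / k * o) * k = k - h + h * o.
      by field; rewrite gt_eqF.
    lra.
  apply: opnorm_le => // y y1; rewrite actE.
  have -> : y + h *: (A *m y) =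
      (1 - h / k) *: y + (h / k) *: ((1%:M + k *: A) *m y).
    rewrite actE scalerDr scalerA divfK ?gt_eqF// addrA -scalerDl subrK.
    by rewrite scale1r.
  apply: le_trans (NT _ _) _;
    rewrite !NZ !ger0_norm ?subr_ge0// y1 mulr1 lerD2l.
  by rewrite ler_wpM2l// -[leRHS]mulr1 -y1 le_opnorm.
have lbg : has_lbound (g @` `]0, 1[).
  exists (- (C * `|A|)) => _ [h /= + <-]; rewrite in_itv /= => /andP[h0 _].
  rewrite /g ler_pdivlMr//.
  have := le_opnorm (1%:M + h *: A) z hN; rewrite z1 mulr1 actE.
  have : N z <= N (z + h *: (A *m z)) + h * (C * `|A|).
    rewrite -{1}[z](addrK (h *: (A *m z))) .
    apply: le_trans (NT _ _) _; rewrite lerD2l (is_normN _ hN) NZ gtr0_norm//.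
    by rewrite ler_pM2l//; have := NC A z; rewrite z1 mulr1.
  by rewrite z1; lra.
have cvg : lognorm N A = inf (g @` `]0, 1[).
  apply: cvg_lim => //;
    apply: (@nondecreasing_at_right_cvgr _ g 0 (BLeft 1)) => //.
  by rewrite bnd_simp.
rewrite cvg => /inf_lt []; first by exists (g 2^-1), 2^-1 => //=;
  rewrite in_itv /=; lra.
move=> _ [h /= + <-]; rewrite in_itv /= => /andP[h0 _] gl.
exists h => // y; rewrite -actE; apply: le_trans (le_opnorm _ _ hN) _.
rewrite ler_wpM2r//; move: gl; rewrite /g ltr_pdivrMr//; lra.
Qed.

(** The point [x + h *: y] lies on the segment from [x] to [x + k *: y], so by convexity a bound at
    one step size is inherited by every smaller one. *)
Lemma step_smaller {R : realType} {n} {N : 'cV[R]_n -> R} (x y : 'cV[R]_n) l h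
  k r :
  is_norm N -> 0 < h -> h <= k -> N x <= r ->
  N (x + k *: y) <= (1 + k * l) * r -> N (x + h *: y) <= (1 + h * l) * r.
Proof.
move=> hN h0 hk xr kr; have [N0 _ NZ NT] := hN.
have k0 : 0 < k by apply: lt_le_trans hk.
have -> : x + h *: y = (1 - h / k) *: x + (h / k) *: (x + k *: y).
  by rewrite scalerDr scalerA divfK ?gt_eqF// addrA -scalerDl subrK scale1r.
have {}hk : 0 <= 1 - h / k by rewrite subr_ge0 ler_pdivrMr// mul1r.
have hk0 : 0 <= h / k by rewrite divr_ge0// ltW.
apply: le_trans (NT _ _) _; rewrite !NZ !ger0_norm//.
apply: le_trans (lerD (ler_wpM2l hk xr) (ler_wpM2l hk0 kr)) _.
rewrite le_eqVlt; apply/orP; left; apply/eqP; field.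
by rewrite gt_eqF.
Qed.

(** Each matrix has its own step size, which serves all smaller steps and, at the price of [e / 2],
    all nearby matrices; compactness then leaves a common one. *)
Lemma lognorm_le_step_compact {R : realType} {n} {N : 'cV[R]_n -> R}
    (K : set 'M[R]_n) l e :
  is_norm N -> compact K -> (forall A, K A -> lognorm N A <= l) -> 0 < e ->
  exists2 d, 0 < d & forall A h, K A -> 0 < h <= d ->
    forall x, N (x + h *: (A *m x)) <= (1 + h * (l + e)) * N x.
Proof.
move=> hN cK lK e0; have [N0 _ NZ NT] := hN.
have [C C0 NC] := is_norm_mulmx hN.
have F0 : Filter (0 : R)^'+ by exact: at_right_proper_filter.
have ncov := (iffLR (compact_near_coveringP K)) cK _ (0^'+) (fun h A =>
  forall x, N (x + h *: (A *m x)) <= (1 + h * (l + e)) * N x) F0.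
have [|d /= d0 hd] := ncov.
  move=> A KA.
  have [h0 h00 hA] : exists2 h, 0 < h & forall x,
      N (x + h *: (A *m x)) <= (1 + h * (l + e / 2)) * N x.
    apply: lognorm_lt_step => //; apply: le_lt_trans (lK A KA) _.
    by rewrite ltrDl divr_gt0.
  (* The radius satisfies [C * b = e / 2], the share of the slack left to the perturbation
     [A' - A]. *)
  pose b := e / 2 / C; have b0 : 0 < b by rewrite !divr_gt0.
  exists (ball A b, [set h | 0 < h <= h0]).
    split; first exact: nbhsx_ballx.
    near=> h => /=; apply/andP; split; near: h; first exact: nbhs_right_gt.
    exact: nbhs_right_le.
  move=> [A' h] [/= bA /andP[hp hh0]] x.
  apply: (step_smaller _ _ _ _ h0) => //.
  have -> : x + h0 *: (A' *m x) =
     (x + h0 *: (A *m x)) + h0 *: ((A' - A) *m x).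
    by rewrite mulmxBl scalerBr addrA [RHS]addrAC addrK.
  apply: le_trans (NT _ _) _; rewrite NZ gtr0_norm//.
  have h1 : h0 * N ((A' - A) *m x) <= h0 * (e / 2 * N x).
    rewrite ler_pM2l//; apply: le_trans (NC _ _) _; rewrite ler_wpM2r//.
    rewrite mulrC -ler_pdivlMr// distrC ltW//.
    by move: bA; rewrite mx_norm_ball.
  by have := hA x; lra.
(* The neighbourhood of 0 gives a strict bound by [d]; halving turns it into the closed condition on
   [h]. *)
exists (d / 2); first by rewrite divr_gt0.
move=> A h KA /andP[h0 hd2] x; apply: (hd h) => //=.
by rewrite sub0r normrN gtr0_norm//; lra.
Unshelve. all: by end_near. Qed.

(** * Mean value inequality and vector integrals *)

Lemma diff_vdot {R : realType} {n} (p z : 'cV[R]_n) :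
  differentiable (vdot p) z /\ 'd (vdot p) z = vdot p :> ('cV[R]_n -> R).
Proof.
have @f : {linear 'cV[R]_n -> R}.
  exists (vdot p); do 2![eexists]; do ?[constructor].
  - exact: vdot0r.
  - exact: vdotDr.
  - by move=> a x; rewrite vdotZr.
have fE : vdot p = f by [].
have df x : differentiable (vdot p) x.
  have -> : vdot p = \sum_i (p i ord0 *: fun z : 'cV[R]_n => z i ord0).
    by apply/funext => w; rewrite fct_sumE vdotE.
  apply: differentiable_sum => i; apply: differentiableZ.
  exact: differentiable_coord.
split => //; rewrite fE; apply: diff_lin => x.
by rewrite -fE; exact: differentiable_continuous.
Qed.

Lemma jac_mulmx {R : realType} {n m} (F : 'cV[R]_n -> 'cV[R]_m) x w :
  differentiable F x -> 'd F x w = jac F x *m w.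
Proof.
move=> dF; apply/matrixP => i j; rewrite (ord1 j) [in LHS](cV_delta_sum w).
rewrite linear_sum summxE mxE; apply: eq_bigr => k _.
by rewrite linearZ /= !mxE -deriveE// mulrC.
Qed.

(** A vector-valued map has no mean value equality, so the scalar theorem is applied along the
    segment after pairing with a [p] that norms the left-hand side. Keeping the identity together
    with [h *: F] preserves a factor [r] that may be below 1; bounding them separately would lose
    the contraction. *)
Lemma mean_value_step {R : realType} {n} {N : 'cV[R]_n -> R}
    (F : 'cV[R]_n -> 'cV[R]_n) h r (x y : 'cV[R]_n) :
  is_norm N -> (forall z, differentiable F z) ->
  (forall t w, 0 <= t <= 1 ->
     N (w + h *: (jac F (y + t *: (x - y)) *m w)) <= r * N w) ->
  N ((x - y) + h *: (F x - F y)) <= r * N (x - y).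
Proof.
move=> hN dF H.
have [p [pN pE]] := hahn_banach_cV ((x - y) + h *: (F x - F y)) hN.
pose line (t : R) : 'cV[R]_n := y + t *: (x - y).
pose q (t : R) := vdot p (line t) + h * vdot p (F (line t)).
pose dq t := vdot p ((x - y) + h *: (jac F (line t) *m (x - y))).
have dline t : is_diff t line (fun s => s *: (x - y)).
  have a : is_diff t (cst y + (fun s => s *: (x - y)))
      (0 + (fun s => s *: (x - y))) by exact: is_diffD.
  by apply: (is_diff_eq a); rewrite add0r.
have dqP (t : R) : is_derive t (1 : R) q (dq t).
  have d1 z : is_diff z (vdot p) (vdot p).
    by have [? ?] := diff_vdot p z; exact: DiffDef.
  have d2 z : is_diff z F ('d F z) by exact: DiffDef.
  have dqq : is_diff t q (fun s => vdot p (s *: (x - y)) +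
      h * vdot p ('d F (line t) (s *: (x - y)))).
    have a1 := @is_diff_comp _ _ _ _ _ _ _ _ t (dline t) (d1 (line t)).
    have a2 := @is_diff_comp _ _ _ _ _ _ _ _ t (dline t) (d2 (line t)).
    have a3 := @is_diff_comp _ _ _ _ _ _ _ _ t a2 (d1 (F (line t))).
    exact: (@is_diffD _ _ _ _ _ _ _ _ a1 (@is_diffZ _ _ _ _ _ h _ a3)).
  apply: DeriveDef.
    by apply/derivable1_diffP; case: dqq.
  rewrite deriveE; last by case: dqq.
  rewrite (@diff_val _ _ _ _ _ _ _ dqq) scale1r jac_mulmx//.
  by rewrite /dq [RHS]vdotDr vdotZr.
have cq : {within `[0, 1], continuous q}.
  apply: continuous_subspaceT => t.
  by apply: differentiable_continuous; apply/derivable1_diffP; case: (dqP t).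
have [t] := MVT_segment ler01 (fun t _ => dqP t) cq.
rewrite in_itv /= => t01 qE.
apply: (@le_trans _ _ (dq t)); last first.
  by apply: le_trans (pN _) _; exact: H.
rewrite -pE; move: qE; rewrite subr0 mulr1 => <-.
rewrite /q /line scale1r scale0r addr0 (addrC y) subrK.
by rewrite vdotDr vdotZr !vdotBr le_eqVlt; apply/orP; left; apply/eqP; ring.
Qed.

Lemma Rintegral_itv_split {R : realType} (f : R -> R) (a b c : R) :
  (@lebesgue_measure R).-integrable `[a, c] (EFin \o f) -> a <= b <= c ->
  Rintegral (@lebesgue_measure R) `[a, c] f =
  Rintegral (@lebesgue_measure R) `[a, b] f +
  Rintegral (@lebesgue_measure R) `[b, c] f.
Proof.
move=> fi /andP[ab bc].
have fbc : (@lebesgue_measure R).-integrable `]b, c] (EFin \o f).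
  by apply: integrableS fi => //; apply: subset_itv; rewrite bnd_simp// ltW.
rewrite -[X in _ + X]Rintegral_itv_obnd_cbnd//.
by apply/eqP; rewrite addrC -subr_eq (Rintegral_itvB fi)// bnd_simp.
Qed.

Lemma vintegrableS {R : realType} {n} (F : R -> 'cV[R]_n) a b c d :
  vintegrable F a b -> a <= c -> d <= b -> vintegrable F c d.
Proof.
move=> Fi ac db i; apply: integrableS (Fi i) => //.
by apply: subset_itv; rewrite bnd_simp.
Qed.

Lemma vint_split {R : realType} {n} (F : R -> 'cV[R]_n) a b c :
  vintegrable F a c -> a <= b <= c -> vint F a c = vint F a b + vint F b c.
Proof.
move=> Fi abc; apply/colP => i; rewrite !mxE.
by apply: Rintegral_itv_split => //; exact: Fi.
Qed.

Lemma vintegrableB {R : realType} {n} (F G : R -> 'cV[R]_n) a b :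
  vintegrable F a b -> vintegrable G a b -> vintegrable (fun s => F s - G s) a
    b.
Proof.
move=> Fi Gi i;
  apply: (eq_integrable _ _ _ _ (integrableB _ (Fi i) (Gi i))) => //.
by move=> s _; rewrite !mxE EFinB.
Qed.

Lemma vintB {R : realType} {n} (F G : R -> 'cV[R]_n) a b :
  vintegrable F a b -> vintegrable G a b ->
  vint (fun s => F s - G s) a b = vint F a b - vint G a b.
Proof.
move=> Fi Gi; apply/colP => i; rewrite !mxE.
rewrite -RintegralB//; [|exact: Fi|exact: Gi].
by apply: eq_Rintegral => s _; rewrite !mxE.
Qed.

Lemma vdot_vint {R : realType} {n} (F : R -> 'cV[R]_n) p a b :
  vintegrable F a b ->
  (@lebesgue_measure R).-integrable `[a, b] (EFin \o (fun s => vdot p (F s))) /\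
  vdot p (vint F a b) =
    Rintegral (@lebesgue_measure R) `[a, b] (fun s => vdot p (F s)).
Proof.
move=> Fi; rewrite vdotE.
under [X in EFin \o X]eq_fun do rewrite vdotE.
under [X in Rintegral _ _ X]eq_fun do rewrite vdotE.
elim: (index_enum _) => [|i r [Ir Er]].
  rewrite big_nil.
  have -> : (fun s => \sum_(i <- [::]) p i ord0 * F s i ord0) = cst (0 : R).
    by apply/funext => s; rewrite big_nil.
  split; first exact: integrable0.
  by rewrite Rintegral_cst// mul0r.
have Zi : (@lebesgue_measure R).-integrable `[a, b]
    (EFin \o (fun s => p i ord0 * F s i ord0)).
  by apply: (eq_integrable _ _ _ _ (integrableZl _ (p i ord0) (Fi i))).
have -> : (fun s => \sum_(j <- i :: r) p j ord0 * F s j ord0) =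
    (fun s => p i ord0 * F s i ord0 + \sum_(j <- r) p j ord0 * F s j ord0).
  by apply/funext => s; rewrite big_cons.
rewrite big_cons Er; split.
  by apply: (eq_integrable _ _ _ _ (integrableD _ Zi Ir)).
by rewrite RintegralD// RintegralZl ?mxE//; exact: Fi.
Qed.

Lemma vdot_vint_le {R : realType} {n} (F : R -> 'cV[R]_n) p a b M :
  vintegrable F a b -> a <= b -> (forall s, a <= s <= b -> vdot p (F s) <= M) ->
  vdot p (vint F a b) <= (b - a) * M.
Proof.
move=> Fi ab FM; have [pFi ->] := vdot_vint F p a b Fi.
have -> : (b - a) * M = Rintegral (@lebesgue_measure R) `[a, b] (cst M).
  rewrite Rintegral_cst//= mulrC lebesgue_measure_itv/= lte_fin.
  by case: ltgtP ab => // -> _; rewrite subrr.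
apply: le_Rintegral => //.
  apply: continuous_compact_integrable; first exact: segment_compact.
  by apply: continuous_subspaceT => x; exact: cst_continuous.
Qed.

(** * A discrete Gronwall inequality *)

(** This follows from [1 + x <= expR x] and [1 <= (1 - x + x ^+ 2) * (1 + x)]; the quadratic term
    bounds the error of replacing the exponential by an Euler step. *)
Lemma expRN_le {R : realType} (x : R) : 0 <= x -> expR (- x) <= 1 - x + x ^+ 2.
Proof.
move=> x0; have h := expR_ge1Dx x.
have x1 : 0 < 1 + x by rewrite ltr_pwDl.
rewrite expRN; apply: (@le_trans _ _ (1 + x)^-1).
  by rewrite lef_pV2// ?posrE ?expR_gt0.
rewrite -[leLHS]mul1r ler_pdivrMr//.
have -> : (1 - x + x ^+ 2) * (1 + x) = 1 + x ^+ 3 by ring.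
by rewrite lerDl exprn_ge0.
Qed.

(** Euler comparison with [phi], which is [m 0] plus the solution of [y' = b - c y], [y 0 = 0]. The
    term [m 0] is left undamped, which only enlarges [phi] because [0 <= m 0]. *)
Lemma discrete_gronwall {R : realType} (m : R -> R) (T c b : R) :
  0 < c -> 0 <= b -> 0 <= m 0 ->
  (forall e, 0 < e -> exists2 d, 0 < d & forall t h,
     0 <= t -> 0 < h <= d -> t + h <= T ->
     m (t + h) <= (1 - c * h) * m t + h * (b + e)) ->
  forall t, 0 <= t <= T -> m t <= m 0 + b * (c^-1 * (1 - expR (- (c * T)))).
Proof.
move=> c0 b0 m0 H t /andP[t0 tT].
pose phi t := m 0 + b * (c^-1 * (1 - expR (- (c * t)))).
have phiT : phi t <= phi T.
  rewrite lerD2l ler_wpM2l// ler_wpM2l ?invr_ge0 ?(ltW c0)// lerD2l lerN2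
    ler_expR.
  by rewrite lerN2 ler_pM2l.
apply: le_trans phiT.
have phiS s h : 0 <= s -> 0 <= h ->
    (1 - c * h) * phi s + h * b - b * c * h ^+ 2 <= phi (s + h).
  move=> s0 h0; rewrite /phi.
  have ch0 : 0 <= c * h by rewrite mulr_ge0// ltW.
  have := expRN_le _ ch0.
  have -> : - (c * (s + h)) = - (c * s) + - (c * h) by ring.
  rewrite expRD.
  set E := expR (- (c * s)); set F := expR (- (c * h)) => FE.
  have E0 : 0 <= E by exact: expR_ge0.
  have E1 : E <= 1 by rewrite -expR0 ler_expR oppr_le0 mulr_ge0// ltW.
  have EF : E * (F - 1 + c * h) <= (c * h) ^+ 2.
    apply: (@le_trans _ _ (E * (c * h) ^+ 2)); first by rewrite ler_wpM2l//;
      lra.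
    by rewrite -[leRHS]mul1r ler_wpM2r// sqr_ge0.
  have bc : 0 <= b / c by rewrite divr_ge0// ltW.
  have := ler_wpM2l bc EF.
  have -> : b / c * (c * h) ^+ 2 = b * c * h ^+ 2 by field; rewrite gt_eqF.
  have -> : b / c * (E * (F - 1 + c * h)) =
     b / c * (E * F) - b / c * E + b * h * E by field; rewrite gt_eqF.
  have -> : b * (c^-1 * (1 - E * F)) = b / c - b / c * (E * F) by ring.
  have -> : (1 - c * h) * (m 0 + b * (c^-1 * (1 - E))) =
      m 0 - c * h * m 0 + b / c - b / c * E - b * h + b * h * E.
     by field; rewrite gt_eqF.
  have := mulr_ge0 ch0 m0; lra.
apply/ler_addgt0Pr => e e0.
move: t0; rewrite le_eqVlt => /predU1P[<-|t0].
  by rewrite /phi mulr0 oppr0 expR0 subrr !mulr0 addr0 lerDl ltW.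
(* Each step of length [h] adds [2 e' h]: one half from the hypothesis, one half from the Euler
   defect [b * c * h ^+ 2]. Over the total length [t] this sums to [e]. *)
pose e' := e / t / 2; have e'0 : 0 < e' by rewrite !divr_gt0.
have [d d0 Hd] := H _ e'0.
(* The three summands encode the three constraints on the step: [h * r <= 1] gives [h <= d],
   [c * h <= 1] and [b * c * h <= e'] together. *)
pose r := d^-1 + c + b * c / e'.
have d'0 : 0 < d^-1 by rewrite invr_gt0.
have bce : 0 <= b * c / e' by rewrite !mulr_ge0// ?invr_ge0 ltW.
have r0 : 0 < r by rewrite /r; lra.
pose M := Num.bound (t * r).
have tM : t * r < M%:R by apply: archi_boundP; rewrite mulr_ge0// ltW.
have M0' : 0 < M%:R :> R by apply: le_lt_trans tM; rewrite mulr_ge0// ltW.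
pose h := t / M%:R.
have h0 : 0 < h by rewrite divr_gt0.
have hbound : h * r <= 1 by rewrite /h mulrAC ler_pdivrMr// mul1r ltW.
have hd : h <= d.
  rewrite -[d]mul1r -ler_pdivrMr//.
  by apply: le_trans hbound; rewrite ler_pM2l// /r; lra.
have hc : c * h <= 1.
  by apply: le_trans hbound; rewrite mulrC ler_pM2l// /r; lra.
have hb : b * c * h <= e'.
  have : h * (b * c / e') <= 1 by apply: le_trans hbound;
    rewrite ler_pM2l// /r; lra.
  by rewrite mulrA ler_pdivrMr// mul1r mulrC.
have step j : (j <= M)%N -> m (j%:R * h) <= phi (j%:R * h) + e' * 2 * (j%:R *
  h).
  elim: j => [_|j IH jM];
    first by rewrite /phi !(mul0r, mulr0, oppr0) expR0 subrr !mulr0 !addr0.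
  have jh0 : 0 <= j%:R * h by rewrite mulr_ge0// ltW.
  rewrite -natr1 mulrDl mul1r; apply: le_trans (Hd _ h _ _ _) _ => //.
  - by rewrite h0.
  - rewrite -[X in _ + X]mul1r -mulrDl natr1; apply: le_trans tT.
    by rewrite /h mulrCA ler_piMr ?(ltW t0)// ler_pdivrMr// mul1r ler_nat.
  have ch1 : 0 <= 1 - c * h by lra.
  have := ler_wpM2l ch1 (IH (ltnW jM)).
  have := phiS _ _ jh0 (ltW h0).
  have := ler_wpM2l (ltW h0) hb.
  have : 0 <= c * h * (e' * 2 * (j%:R * h)).
    apply: mulr_ge0; first by rewrite mulr_ge0// ltW.
    by apply: mulr_ge0 => //; rewrite mulr_ge0// ltW.
  lra.
have := step M (leqnn _).
have -> : M%:R * h = t by rewrite /h mulrC divfK// gt_eqF.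
by have -> : e' * 2 * t = e by rewrite /e'; field; rewrite gt_eqF.
Qed.

(** * State and costate estimates *)

(** The norming functional is chosen for the whole integral and does not depend on [s], so only
    scalar pairings are integrated, never [N (F s)]. *)
Lemma norm_vint_le {R : realType} {n} {N : 'cV[R]_n -> R} (F : R -> 'cV[R]_n) a
  b M :
  is_norm N -> vintegrable F a b -> a <= b ->
  (forall s, a <= s <= b -> N (F s) <= M) -> N (vint F a b) <= (b - a) * M.
Proof.
move=> hN Fi ab FM; have [p [pN <-]] := hahn_banach_cV (vint F a b) hN.
apply: vdot_vint_le => // s sab; apply: le_trans (pN _) _; exact: FM.
Qed.

Lemma dualnorm_vint_le {R : realType} {n} {N : 'cV[R]_n -> R}
    (F : R -> 'cV[R]_n) a b M :
  is_norm N -> vintegrable F a b -> a <= b ->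
  (forall s y, a <= s <= b -> N y <= 1 -> vdot y (F s) <= M) ->
  dualnorm N (vint F a b) <= (b - a) * M.
Proof.
move=> hN Fi ab FM; apply: dualnorm_le => // y y1.
by apply: vdot_vint_le => // s sab; exact: FM.
Qed.

Lemma vint_point {R : realType} {n} (F : R -> 'cV[R]_n) a : vint F a a = 0.
Proof. by apply/colP => i; rewrite !mxE set_itv1 Rintegral_set1. Qed.

Lemma vdotDl {R : realType} {n} (y z w : 'cV[R]_n) :
  vdot (y + z) w = vdot y w + vdot z w.
Proof. by rewrite vdotC vdotDr !(vdotC w). Qed.

(** Since [d *: y] is the difference of [x + d *: y] and [x], a step bound at one size also bounds
    the increment. The resulting Lipschitz constants are crude, but enter only errors that vanish
    with the step size. *)
Lemma step_lipschitz {R : realType} {n} {N : 'cV[R]_n -> R} (x y : 'cV[R]_n) d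
  r :
  is_norm N -> 0 < d -> N x <= r -> N (x + d *: y) <= r -> N y <= 2 / d * r.
Proof.
move=> hN d0 xr xyr; have [_ _ NZ NT] := hN.
rewrite mulrAC ler_pdivlMr// mulrC.
have -> : d * N y = N (d *: y) by rewrite NZ gtr0_norm.
have -> : d *: y = (x + d *: y) + (- x) by rewrite addrAC subrr add0r.
by apply: le_trans (NT _ _) _; rewrite (is_normN _ hN); lra.
Qed.

Section state_estimate.
Context {R : realType} {n k : nat} (N : 'cV[R]_n -> R) (T c : R)
  (f : R -> 'cV[R]_n -> 'cV[R]_k -> 'cV[R]_n) (U : set 'cV[R]_k) (B : set
    'cV[R]_n).
Hypotheses (hN : is_norm N) (T0 : 0 < T) (c0 : 0 < c).
Hypothesis f_step : forall e, 0 < e -> exists2 d, 0 < d &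
  forall s h x y u, 0 <= s <= T -> 0 < h <= d -> B x -> B y -> U u ->
    N ((x - y) + h *: (f s x u - f s y u)) <= (1 + h * (- c + e)) * N (x - y).

Let f_lip : exists2 C, 0 < C & forall s x y u, 0 <= s <= T -> B x -> B y -> U u
  ->
  N (f s x u - f s y u) <= C * N (x - y).
Proof.
(* With [e = c] the factor in [f_step] is 1. *)
have [d d0 hd] := f_step c c0; exists (2 / d); first by rewrite divr_gt0.
move=> s x y u sT Bx By Uu; apply: (step_lipschitz (x - y)) => //.
have := hd s d x y u sT _ Bx By Uu; rewrite d0 lexx => /(_ isT).
by rewrite addNr mulr0 addr0 mul1r.
Qed.

Lemma state_estimate (x0 : 'cV[R]_n) (M b : R) (u v : R -> 'cV[R]_k)
    (x y : R -> 'cV[R]_n) :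
  (forall s z w, 0 <= s <= T -> B z -> U w -> N (f s z w) <= M) ->
  (forall s, 0 <= s <= T -> [/\ U (u s), U (v s), B (x s) & B (y s)]) ->
  (forall s, 0 <= s <= T -> N (f s (y s) (u s) - f s (y s) (v s)) <= b) ->
  is_state f x0 T u x -> is_state f x0 T v y ->
  forall t, 0 <= t <= T -> N (x t - y t) <= b * (c^-1 * (1 - expR (- (c * T)))).
Proof.
have [N0 _ NZ NT] := hN.
move=> fM inUB fb [Fi Fx] [Gi Gy].
set F := fun s => f s (x s) (u s) in Fi Fx.
set G := fun s => f s (y s) (v s) in Gi Gy.
have M0 : 0 <= M.
  have [U0 _ B0 _] := inUB 0 (introT andP (conj (lexx _) (ltW T0))).
  apply: le_trans (N0 _) (fM 0 (x 0) (u 0) _ B0 U0).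
  by rewrite lexx ltW.
have b0 : 0 <= b.
  by apply: le_trans (N0 _) (fb 0 _); rewrite lexx ltW.
have incr (z : R -> 'cV[R]_n) (H : R -> 'cV[R]_n) s t : vintegrable H 0 T ->
    (forall t, 0 <= t <= T -> z t = x0 + vint H 0 t) ->
    0 <= s -> s <= t -> t <= T -> z t - z s = vint H s t.
  move=> Hi Hz s0 st tT.
  rewrite !Hz ?s0 ?tT ?(le_trans s0 st) ?(le_trans st tT)//.
  rewrite (vint_split H 0 s t) ?s0 ?st//; last exact: vintegrableS Hi _ _.
  by rewrite opprD addrACA subrr add0r addrAC subrr add0r.
have FM s : 0 <= s <= T -> N (F s) <= M.
  by move=> sT; have [? _ ? _] := inUB s sT; apply: fM.
have GM s : 0 <= s <= T -> N (G s) <= M.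
  by move=> sT; have [_ ? _ ?] := inUB s sT; apply: fM.
have incr_le (z : R -> 'cV[R]_n) (H : R -> 'cV[R]_n) s t : vintegrable H 0 T ->
    (forall t, 0 <= t <= T -> z t = x0 + vint H 0 t) ->
    (forall s, 0 <= s <= T -> N (H s) <= M) ->
    0 <= s -> s <= t -> t <= T -> N (z t - z s) <= (t - s) * M.
  move=> Hi Hz HM s0 st tT; rewrite (incr z H)//.
  apply: norm_vint_le => //; first exact: vintegrableS Hi _ _.
  by move=> r /andP[sr rt]; rewrite HM// (le_trans s0 sr) (le_trans rt tT).
have T00 : (0 : R) <= 0 <= T by rewrite lexx ltW.
have xy0 : x 0 - y 0 = 0 by rewrite Fx// Gy// !vint_point subrr.
(* The slack in [f_step] multiplies the difference itself, so an a priori bound on it is needed to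
   make the resulting error uniform. *)
have Mw t : 0 <= t <= T -> N (x t - y t) <= 2 * (T * M).
  move=> /andP[t0 tT].
  have -> : x t - y t = (x t - x 0) + (- (y t - y 0)).
    by rewrite (subr0_eq xy0) opprB addrA subrK.
  apply: le_trans (NT _ _) _; rewrite (is_normN _ hN).
  have h1 := incr_le x F 0 t Fi Fx FM (lexx _) t0 tT.
  have h2 := incr_le y G 0 t Gi Gy GM (lexx _) t0 tT.
  have := ler_wpM2r M0 tT; lra.
have [C C0 fC] := f_lip.
move=> t tT.
rewrite -[leRHS]add0r -(is_norm0 hN) -xy0.
apply: (discrete_gronwall (fun t => N (x t - y t))) => //.
move=> {t tT} e e0.
have TM0 : 0 <= T * M by rewrite mulr_ge0// ltW.
have CM0 : 0 <= C * M by rewrite mulr_ge0// ltW.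
(* Half of [e] pays for the slack times [N (x t - y t)], the other half, through the bound on [h],
   for the freezing errors [2 C M h]; the added 1 keeps each denominator positive. *)
have e10 : 0 < e / 2 / (2 * (T * M) + 1) by rewrite !divr_gt0//; lra.
have [d1 d10 hd1] := f_step _ e10.
have d20 : 0 < e / 2 / (2 * (C * M) + 1) by rewrite !divr_gt0//; lra.
exists (Num.min d1 (e / 2 / (2 * (C * M) + 1)));
  first by rewrite lt_min d10 d20.
move=> t h t0 /andP[h0]; rewrite le_min => /andP[hhd1 hhd2] thT.
set e1 := e / 2 / _ in e10 hd1.
have tT : 0 <= t <= T by rewrite t0/=; lra.
have [p [pN pE]] := hahn_banach_cV (x (t + h) - y (t + h)) hN.
have tth : t <= t + h by lra.
have Fi' : vintegrable F t (t + h) by exact: vintegrableS Fi _ _.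
have Gi' : vintegrable G t (t + h) by exact: vintegrableS Gi _ _.
have wE : x (t + h) - y (t + h) = (x t - y t) + vint (fun s => F s - G s) t (t
  + h).
  rewrite vintB// -(incr x F)// -(incr y G)//.
  by apply/colP => i; rewrite !mxE; ring.
pose K := ((1 + h * (- c + e1)) * N (x t - y t) - vdot p (x t - y t)) / h +
   2 * (C * M) * h + b.
have key : vdot p (vint (fun s => F s - G s) t (t + h)) <= (t + h - t) * K.
  apply: vdot_vint_le => //; first exact: vintegrableB.
  move=> s /andP[ts sth].
  have s0 : 0 <= s by exact: le_trans ts.
  have sT' : s <= T by exact: le_trans thT.
  have sT : 0 <= s <= T by rewrite s0.
  have [Uus Uvs Bxs Bys] := inUB s sT.
  have [_ _ Bxt Byt] := inUB t tT.
  (* Four parts: the contraction at the states frozen at [t], the two freezing errors, and the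
     forcing due to [u s] against [v s]. *)
  have -> : F s - G s = (f s (x t) (u s) - f s (y t) (u s)) +
      (f s (x s) (u s) - f s (x t) (u s)) + (f s (y t) (u s) - f s (y s) (u s))
        +
      (f s (y s) (u s) - f s (y s) (v s)).
    by apply/colP => i; rewrite !mxE /F /G; ring.
  rewrite 3!vdotDr /K; apply: lerD; last first.
    by apply: le_trans (pN _) _; exact: fb.
  rewrite -addrA; apply: lerD.
    rewrite ler_pdivlMr// lerBrDl [X in _ + X]mulrC -vdotZr -vdotDr.
    by apply: le_trans (pN _) _; apply: hd1 => //; rewrite h0.
  have sub_h z H : vintegrable H 0 T ->
    (forall t, 0 <= t <= T -> z t = x0 + vint H 0 t) ->
    (forall s, 0 <= s <= T -> N (H s) <= M) -> N (z s - z t) <= M * h.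
    move=> Hi Hz HM; apply: le_trans (incr_le z H t s Hi Hz HM t0 ts sT') _.
    by rewrite mulrC ler_wpM2l//; lra.
  have h1 : N (f s (x s) (u s) - f s (x t) (u s)) <= C * (M * h).
    apply: le_trans (fC _ _ _ _ sT Bxs Bxt Uus) _.
    by rewrite ler_pM2l//; exact: sub_h Fi Fx FM.
  have h2 : N (f s (y t) (u s) - f s (y s) (u s)) <= C * (M * h).
    apply: le_trans (fC _ _ _ _ sT Byt Bys Uus) _.
    by rewrite ler_pM2l// (is_normB _ _ hN); exact: sub_h Gi Gy GM.
  have := pN (f s (x s) (u s) - f s (x t) (u s)).
  have := pN (f s (y t) (u s) - f s (y s) (u s)).
  lra.
rewrite -pE wE vdotDr.
have hK : (t + h - t) * K = (1 + h * (- c + e1)) * N (x t - y t)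
   - vdot p (x t - y t) + h * (2 * (C * M) * h + b).
  by rewrite /K; field; rewrite gt_eqF.
rewrite hK in key.
have e1w : h * (e1 * N (x t - y t)) <= h * (e / 2).
  have D0 : 0 < 2 * (T * M) + 1 by lra.
  rewrite ler_pM2l// /e1 mulrAC ler_pdivrMr//.
  apply: ler_wpM2l; first by rewrite ltW// divr_gt0.
  by have := Mw t tT; lra.
have h2w : h * (2 * (C * M) * h) <= h * (e / 2).
  rewrite ler_pM2l//; move: hhd2; rewrite ler_pdivlMr; last by lra.
  by lra.
lra.
Qed.

End state_estimate.

(** Pairing with [y] in the unit ball of [N] moves [(A s)^T] onto [y] as [A s], so the step bound
    for [A] in [N] serves the dual norm and no logarithmic norm of a transpose is computed. The
    forcing is the part of [g] left after removing [(A s)^T *m del s]. *)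
Lemma costate_estimate {R : realType} {n} (N : 'cV[R]_n -> R) (T c b Md : R)
    (A : R -> 'M[R]_n) (g del : R -> 'cV[R]_n) (delT : 'cV[R]_n) :
  is_norm N -> 0 < T -> 0 < c ->
  (forall e, 0 < e -> exists2 d, 0 < d &
    forall s h y, 0 <= s <= T -> 0 < h <= d ->
      N (y + h *: (A s *m y)) <= (1 + h * (- c + e)) * N y) ->
  vintegrable g 0 T ->
  (forall t, 0 <= t <= T -> del t = delT + vint g t T) ->
  (forall s, 0 <= s <= T -> dualnorm N (g s - (A s)^T *m del s) <= b) ->
  (forall s, 0 <= s <= T -> dualnorm N (del s) <= Md) ->
  forall t, 0 <= t <= T ->
    dualnorm N (del t) <= dualnorm N (del T) + b * (c^-1 * (1 - expR (- (c *
      T)))).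
Proof.
move=> hN T0 c0 A_step gi delE qb delM.
have [N0 _ NZ NT] := hN.
have T00 : (0 : R) <= 0 <= T by rewrite lexx ltW.
have b0 : 0 <= b by apply: le_trans (dualnorm_ge0 _ hN) (qb 0 T00).
have Md0 : 0 <= Md by apply: le_trans (dualnorm_ge0 _ hN) (delM 0 T00).
have [C C0 AC] : exists2 C, 0 < C & forall s y, 0 <= s <= T -> N y <= 1 -> N (A
  s *m y) <= C.
  have [d d0 hd] := A_step c c0; exists (2 / d); first by rewrite divr_gt0.
  move=> s y sT y1; rewrite -[leRHS]mulr1.
  apply: (step_lipschitz y) => //; apply: le_trans y1.
  have := hd s d y sT; rewrite d0 lexx => /(_ isT).
  by rewrite addNr mulr0 addr0 mul1r.
have CMd : 0 <= C * Md by rewrite mulr_ge0// ltW.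
pose L := C * Md + b; have L0 : 0 <= L by rewrite addr_ge0.
have gE s : g s = (A s)^T *m del s + (g s - (A s)^T *m del s).
  by rewrite addrC subrK.
have gL s y : 0 <= s <= T -> N y <= 1 -> vdot y (g s) <= L.
  move=> sT y1; rewrite gE vdotDr; apply: lerD; last first.
    by apply: le_trans (vdot_le_dualnorm1 _ _ hN y1) _; exact: qb.
  rewrite vdot_trmx; apply: le_trans (vdot_le_dualnorm _ _ hN) _.
  apply: ler_pM => //; [exact: dualnorm_ge0|exact: AC|exact: delM].
have incr s t : 0 <= s -> s <= t -> t <= T -> del s - del t = vint g s t.
  move=> s0 st tT.
  rewrite !delE ?s0 ?tT ?(le_trans s0 st) ?(le_trans st tT)//.
  rewrite (vint_split g s t T) ?tT ?st//; last exact: vintegrableS gi _ _.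
  by rewrite opprD addrACA subrr add0r addrK.
have incr_le s t : 0 <= s -> s <= t -> t <= T ->
    dualnorm N (del s - del t) <= (t - s) * L.
  move=> s0 st tT; rewrite incr//.
  apply: dualnorm_vint_le => //; first exact: vintegrableS gi _ _.
  by move=> r y /andP[sr rt]; apply: gL;
    rewrite (le_trans s0 sr) (le_trans rt tT).
move=> t /andP[t0 tT].
have tT' : 0 <= T - t <= T by rewrite subr_ge0 tT lerBlDr lerDl.
have := discrete_gronwall (fun t => dualnorm N (del (T - t))) T c b c0 b0.
rewrite subr0 dualnorm_ge0// => /(_ isT) H; rewrite -(subKr T t);
  apply: H => //.
move=> {t t0 tT tT'} e e0.
have CL0 : 0 <= C * L by rewrite mulr_ge0// ltW.
have e10 : 0 < e / 2 / (Md + 1) by rewrite !divr_gt0//; lra.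
have [d1 d10 hd1] := A_step _ e10.
have d20 : 0 < e / 2 / (C * L + 1) by rewrite !divr_gt0//; lra.
have c'0 : 0 < c^-1 by rewrite invr_gt0.
(* The cap [c^-1] keeps the step factor nonnegative, so that [N y <= 1] may be multiplied by it. *)
exists (Num.min (Num.min d1 c^-1) (e / 2 / (C * L + 1))).
  by rewrite !lt_min d10 d20 c'0.
move=> t h t0 /andP[h0]; rewrite !le_min => /andP[/andP[hhd1 hc] hhd2] thT.
set e1 := e / 2 / _ in e10 hd1.
have ch1 : 0 <= 1 + h * (- c + e1).
  have : h * c <= 1 by rewrite -ler_pdivlMr// div1r.
  by have := mulr_ge0 (ltW h0) (ltW e10); lra.
have sg0 : 0 <= T - (t + h) by lra.
have sgT : T - t <= T by lra.
have sgsg : T - (t + h) <= T - t by lra.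
have tT : 0 <= T - t <= T by rewrite sgT/=; lra.
apply: dualnorm_le => // y y1.
have gi' : vintegrable g (T - (t + h)) (T - t) by exact: vintegrableS gi _ _.
pose m := dualnorm N (del (T - t)).
(* Only the costate difference is frozen, at [T - t]; [A s] still varies, its step bound being
   uniform in [s]. Hence a single freezing error [C * L * h]. *)
pose K := ((1 + h * (- c + e1)) * m - vdot y (del (T - t))) / h + C * L * h + b.
have key : vdot y (vint g (T - (t + h)) (T - t)) <= (T - t - (T - (t + h))) * K.
  apply: vdot_vint_le => // s /andP[ts sth].
  have s0 : 0 <= s by exact: le_trans ts.
  have sT' : s <= T by exact: le_trans sgT.
  have sT : 0 <= s <= T by rewrite s0.
  have -> : g s = (A s)^T *m del (T - t) + (A s)^T *m (del s - del (T - t)) +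
      (g s - (A s)^T *m del s).
    by rewrite -mulmxDr [del (T - t) + _]addrC subrK addrC subrK.
  rewrite vdotDr /K; apply: lerD; last first.
    by apply: le_trans (vdot_le_dualnorm1 _ _ hN y1) _; exact: qb.
  rewrite vdotDr !vdot_trmx; apply: lerD.
    rewrite ler_pdivlMr// lerBrDl [X in _ + X]mulrC -vdotZl -vdotDl.
    apply: le_trans (vdot_le_dualnorm _ _ hN) _.
    rewrite ler_wpM2r ?dualnorm_ge0//.
    apply: le_trans (hd1 s h y sT _) _; first by rewrite h0.
    by rewrite -[leRHS]mulr1 ler_wpM2l.
  apply: le_trans (vdot_le_dualnorm _ _ hN) _.
  rewrite -mulrA; apply: ler_pM => //; [exact: dualnorm_ge0|exact: AC|].
  apply: le_trans (incr_le _ _ s0 sth sgT) _.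
  by rewrite mulrC ler_wpM2l//; lra.
have -> : del (T - (t + h)) = del (T - t) + vint g (T - (t + h)) (T - t).
  by rewrite -incr//; apply/colP => i; rewrite !mxE; ring.
rewrite vdotDr.
have hK : (T - t - (T - (t + h))) * K = (1 + h * (- c + e1)) * m
   - vdot y (del (T - t)) + h * (C * L * h + b).
  by rewrite /K; field; rewrite gt_eqF.
rewrite hK in key.
have e1w : h * (e1 * m) <= h * (e / 2).
  have D0 : 0 < Md + 1 by lra.
  rewrite ler_pM2l// /e1 mulrAC ler_pdivrMr//.
  apply: ler_wpM2l; first by rewrite ltW// divr_gt0.
  by have := delM _ tT; rewrite -/m; lra.
have h2w : h * (C * L * h) <= h * (e / 2).
  rewrite ler_pM2l//; move: hhd2; rewrite ler_pdivlMr; last by lra.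
  by lra.
rewrite -/m; lra.
Qed.

(** * Fixed points of contractions of admissible controls *)

Lemma bounded_set_le {R : realType} {n} (X : set 'cV[R]_n) : bounded_set X ->
  exists2 r, 0 < r & forall x, X x -> `|x| <= r.
Proof.
move=> [M [Mr hM]]; exists (`|M| + 1); first by rewrite ltr_wpDl.
by move=> x Xx; apply: hM => //; rewrite ltr_pwDr// ler_norm.
Qed.

Lemma geometric_lt {R : realType} (C L e : R) : 0 <= L < 1 -> 0 < e ->
  exists n, forall m, (n <= m)%N -> C * L ^+ m < e.
Proof.
move=> /andP[L0 L1] e0.
have : (fun n => C * L ^+ n) @ \oo --> C * 0.
  by apply: cvgMl_tmp; apply: cvg_expr; rewrite ger0_norm.
rewrite mulr0 => /cvgr0Pnorm_lt /(_ _ e0) [n _ hn]; exists n => m nm.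
by apply: le_lt_trans (ler_norm _) _; exact: hn.
Qed.

Lemma le0_geometric {R : realType} (x C L : R) : 0 <= L < 1 ->
  (forall n, x <= C * L ^+ n) -> x <= 0.
Proof.
move=> L01 xC; rewrite leNgt; apply/negP => x0.
have [n hn] := geometric_lt C L x L01 x0.
by have := lt_le_trans (hn n (leqnn _)) (xC n); rewrite ltxx.
Qed.

Lemma cvg_of_tail_bound {R : realType} (a b : nat -> R) :
  (forall n m, `|a (n + m)%N - a n| <= b n) -> b @ \oo --> 0 ->
  a @ \oo --> lim (a @ \oo) /\ forall n, `|a n - lim (a @ \oo)| <= b n.
Proof.
move=> ab b0.
have ca : cvg (a @ \oo).
  apply/cauchy_cvgP/cauchy_exP => e e0.
  have [n _ hn] := iffLR (cvgr0Pnorm_lt _) b0 e e0.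
  exists (a n); exists n => // m /= nm.
  rewrite /ball /= distrC -(subnKC nm).
  apply: le_lt_trans (ab _ _) _; apply: le_lt_trans (ler_norm _) _.
  exact: (hn n (leqnn n)).
split => // n.
have cn : (fun m => `|a n - a m|) @ \oo --> `|a n - lim (a @ \oo)|.
  by apply: cvg_norm; apply: cvgB => //; exact: cvg_cst.
rewrite -(cvg_lim _ cn)//; apply: limr_le; first exact: (cvgP _ cn).
exists n => // m /= nm.
by rewrite distrC -(subnKC nm).
Qed.

Section unorm.
Context {R : realType} {k : nat} (NU : 'cV[R]_k -> R) (T : R).
Hypotheses (hN : is_norm NU) (T0 : 0 < T).

Lemma unorm_le (w : R -> 'cV[R]_k) r :
  (forall t, 0 <= t <= T -> NU (w t) <= r) -> unorm NU T w <= r.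
Proof.
move=> h; apply: ge_sup.
  by exists (NU (w 0)), 0 => //=; rewrite in_itv /= lexx ltW.
by move=> _ [t /= + <-]; rewrite in_itv /=; exact: h.
Qed.

Lemma le_unorm (w : R -> 'cV[R]_k) C t :
  (forall t, 0 <= t <= T -> NU (w t) <= C) -> 0 <= t <= T ->
  NU (w t) <= unorm NU T w.
Proof.
move=> wC tT; apply: ub_le_sup; last by exists t => //=; rewrite in_itv.
by exists C => _ [s /= + <-]; rewrite in_itv /=; exact: wC.
Qed.

Lemma le_unorm_admissible (U : set 'cV[R]_k) u v t : compact U ->
  admissible U T u -> admissible U T v -> 0 <= t <= T ->
  NU (u t - v t) <= unorm NU T (fun t => u t - v t).
Proof.
move=> cU [Uu _] [Uv _]; have [_ _ _ NT] := hN.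
have [C C0 NC] := is_norm_le hN.
have [r r0 Ur] := bounded_set_le U (compact_bounded cU).
apply: (le_unorm (fun t => u t - v t) (C * r + C * r)) => s sT.
apply: le_trans (NT _ _) _; rewrite (is_normN _ hN).
by apply: lerD; apply: le_trans (NC _) _; rewrite ler_pM2l//; apply: Ur; auto.
Qed.

Lemma unorm_admissible_ge0 (U : set 'cV[R]_k) u v : compact U ->
  admissible U T u -> admissible U T v -> 0 <= unorm NU T (fun t => u t - v t).
Proof.
move=> cU au av; have [N0 _ _ _] := hN.
apply: le_trans (N0 _) (le_unorm_admissible U u v 0 cU au av _).
by rewrite lexx ltW.
Qed.

End unorm.

Section fixed_point.
Context {R : realType} {k : nat} (NU : 'cV[R]_k -> R) (T L : R)
  (U : set 'cV[R]_k) (S : (R -> 'cV[R]_k) -> R -> 'cV[R]_k).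
Hypotheses (hN : is_norm NU) (T0 : 0 < T) (L01 : 0 <= L < 1)
  (cU : compact U) (U0 : U 0).
Hypothesis S_adm : forall u, admissible U T u -> admissible U T (S u).
Hypothesis S_lip : forall u v, admissible U T u -> admissible U T v ->
  unorm NU T (fun t => S u t - S v t) <= L * unorm NU T (fun t => u t - v t).

Let iter_adm u n : admissible U T u -> admissible U T (iter n S u).
Proof. by move=> au; elim: n => //= n; exact: S_adm. Qed.

Let zero_adm : admissible U T (fun=> 0).
Proof. by split => // i; exact: measurable_cst. Qed.

Let L0 : 0 <= L. Proof. by case/andP: L01. Qed.
Let L1 : 0 < 1 - L. Proof. by case/andP: L01; lra. Qed.
Let NT x y : NU (x + y) <= NU x + NU y. Proof. by case: hN. Qed.
Let un n := iter n S (fun=> 0).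
Let D := unorm NU T (fun t => S (fun=> 0) t - 0).

Let D0 : 0 <= D.
Proof. by apply: (unorm_admissible_ge0 _ _ _ _ U (S _) (fun=> 0)); auto. Qed.

Let un_step n t : 0 <= t <= T -> NU (un n.+1 t - un n t) <= L ^+ n * D.
Proof.
move=> tT.
apply: le_trans (le_unorm_admissible NU T hN U _ _ t cU (iter_adm _ _ zero_adm)
  (iter_adm _ _ zero_adm) tT) _.
elim: n => [|n IH]; first by rewrite expr0 mul1r.
rewrite exprS -mulrA; apply: le_trans (ler_wpM2l L0 IH).
exact: (S_lip _ _ (iter_adm _ n.+1 zero_adm) (iter_adm _ n zero_adm)).
Qed.

Let un_tail n m t : 0 <= t <= T ->
  NU (un (n + m) t - un n t) <= D / (1 - L) * L ^+ n.
Proof.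
move=> tT; rewrite mulrAC ler_pdivlMr//.
(* Multiplied by [1 - L], the geometric sum takes a closed form that goes through the induction. *)
have : NU (un (n + m) t - un n t) * (1 - L) <= D * L ^+ n * (1 - L ^+ m).
  elim: m => [|m IH].
    by rewrite addn0 subrr (is_norm0 hN) mul0r expr0 subrr mulr0.
  have -> : un (n + m.+1) t - un n t =
     (un (n + m).+1 t - un (n + m) t) + (un (n + m) t - un n t).
    by rewrite addnS addrA subrK.
  apply: le_trans (ler_wpM2r (ltW L1) (NT _ _)) _.
  have := ler_wpM2r (ltW L1) (un_step (n + m) t tT).
  by rewrite exprD exprS; lra.
move=> /le_trans; apply; rewrite -[leRHS]mulr1.
apply: ler_wpM2l; first by rewrite mulr_ge0// exprn_ge0.
by rewrite lerBlDr lerDl exprn_ge0.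
Qed.

(** Coordinatewise limits suit admissibility, whose measurability is coordinatewise and passes to
    pointwise limits. Outside [[0, T]] no convergence is claimed, and [unorm] does not see those
    values. *)
Let uh t : 'cV[R]_k := \col_i lim ((fun n => un n t i ord0) @ \oo).

Let un_coord : exists2 C, 0 <= C & forall t, 0 <= t <= T -> forall i,
  (fun n => un n t i ord0) @ \oo --> uh t i ord0 /\
  forall n, `|un n t i ord0 - uh t i ord0| <= C * L ^+ n.
Proof.
have [C C0 NC] := mx_norm_le_is_norm hN.
exists (C * (D / (1 - L)));
  first by rewrite mulr_ge0 ?divr_ge0 ?(ltW C0) ?(ltW L1) ?D0.
move=> t tT i; rewrite mxE.
apply: cvg_of_tail_bound => [n m|].
  have := coord_le_mx_norm (un (n + m) t - un n t) i ord0.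
  rewrite !mxE => /le_trans; apply; apply: le_trans (NC _) _.
  by rewrite -mulrA ler_pM2l//; exact: un_tail.
rewrite -[X in _ --> X](mulr0 (C * (D / (1 - L)))); apply: cvgMl_tmp.
by apply: cvg_expr; rewrite ger0_norm//; case/andP: L01.
Qed.

Let un_uh : exists2 C, 0 <= C & forall n t, 0 <= t <= T ->
  NU (un n t - uh t) <= C * L ^+ n.
Proof.
have [C C0 hC] := un_coord; have [C' C'0 NC'] := is_norm_le hN.
exists (C' * C); first by rewrite mulr_ge0// ltW.
move=> n t tT; apply: le_trans (NC' _) _; rewrite -mulrA ler_pM2l//.
apply: mx_norm_le => [|i j]; first by rewrite mulr_ge0// exprn_ge0.
by rewrite (ord1 j) !mxE; have [_ /(_ n)] := hC t tT i; rewrite mxE.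
Qed.

Let uh_adm : admissible U T uh.
Proof.
have [C C0 hC] := un_coord.
split=> [t tT|i].
  have clU : closed U by apply: compact_closed => //; exact: norm_hausdorff.
  apply: clU => B /nbhs_ballP[e /= e0 eB].
  have [n hn] := geometric_lt C L e L01 e0.
  exists (un n t); split; first by have [+ _] := iter_adm _ n zero_adm; exact.
  apply: eB; rewrite mx_norm_ball /ball_ /= distrC.
  apply: le_lt_trans (hn n (leqnn _)).
  apply: mx_norm_le => [|i j]; first by rewrite mulr_ge0// exprn_ge0.
  by rewrite (ord1 j) !mxE; have [_ /(_ n)] := hC t tT i; rewrite mxE.
apply: (@measurable_fun_cvg _ _ _ _ (fun n t => un n t i ord0)) => [n|t].
  by have [_] := iter_adm _ n zero_adm; exact.
by rewrite /= in_itv /= => tT; have [] := hC t tT i.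
Qed.

Let uh_fix t : 0 <= t <= T -> S uh t = uh t.
Proof.
move=> tT; have [C C0 hC] := un_uh; have [N0 Neq0 _ _] := hN.
apply: subr0_eq; apply: Neq0; apply/eqP; rewrite eq_le N0 andbT.
(* Comparison with the iterate [n.+1] splits the distance into two parts, each at most [C * L ^+ n];
   as [n] is arbitrary, the distance is 0. *)
apply: (le0_geometric _ (2 * C) L) => // n.
have -> : S uh t - uh t = (S uh t - un n.+1 t) + (un n.+1 t - uh t).
  by rewrite addrA subrK.
apply: le_trans (NT _ _) _.
have h1 := hC n.+1 t tT.
have h2 : NU (S uh t - un n.+1 t) <= L * (C * L ^+ n).
  apply: le_trans (le_unorm_admissible NU T hN U _ _ t cU (S_adm _ uh_adm)
    (iter_adm _ _ zero_adm) tT) _.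
  apply: le_trans (S_lip _ _ uh_adm (iter_adm _ n zero_adm)) _.
  apply: ler_wpM2l => //; apply: unorm_le => // s sT.
  by rewrite (is_normB _ _ hN); exact: hC.
have h3 : C * L ^+ n.+1 <= C * L ^+ n.
  rewrite ler_wpM2l// exprS ler_piMl ?exprn_ge0//.
  by case/andP: L01 => _ /ltW.
rewrite exprS in h1 h3; lra.
Qed.

(** The fixed-point equation is known on [[0, T]] only, so [S uh] is replaced by [uh] pointwise
    under the supremum rather than as a function. *)
Let S_uh u : admissible U T u ->
  unorm NU T (fun t => S u t - uh t) <= L * unorm NU T (fun t => u t - uh t).
Proof.
move=> au; apply: le_trans (S_lip _ _ au uh_adm).
apply: unorm_le => // t tT; rewrite -(uh_fix t tT).
exact: (le_unorm_admissible NU T hN U _ _ t cU (S_adm _ au) (S_adm _ uh_adm)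
  tT).
Qed.

Let iter_uh u n : admissible U T u ->
  unorm NU T (fun t => iter n S u t - uh t) <=
  unorm NU T (fun t => u t - uh t) * L ^+ n.
Proof.
move=> au; elim: n => [|n IH]; first by rewrite expr0 mulr1.
rewrite exprS mulrCA; apply: le_trans (ler_wpM2l L0 IH).
by apply: (S_uh (iter n S u)); exact: iter_adm.
Qed.

Lemma admissible_fixed_point : exists uh, admissible U T uh /\
  (forall t, 0 <= t <= T -> S uh t = uh t) /\
  (forall v, admissible U T v -> (forall t, 0 <= t <= T -> S v t = v t) ->
     forall t, 0 <= t <= T -> v t = uh t) /\
  (forall u0, admissible U T u0 ->
     (fun i : nat => unorm NU T (fun t => iter i S u0 t - uh t)) @ \oo --> 0) /\
  (forall u0, admissible U T u0 -> forall (i : nat) t, 0 <= t <= T ->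
     NU (iter i S u0 t - uh t)
       <= L ^+ i / (1 - L) * unorm NU T (fun t => S u0 t - u0 t)).
Proof.
have [N0 Neq0 _ _] := hN.
exists uh; split; [exact: uh_adm|split; [exact: uh_fix|split; [|split]]].
- move=> v av vfix t tT.
  apply: subr0_eq; apply: Neq0; apply/eqP; rewrite eq_le N0 andbT.
  apply: le_trans (le_unorm_admissible NU T hN U _ _ t cU av uh_adm tT) _.
  have h1 := unorm_admissible_ge0 NU T hN T0 U _ _ cU av uh_adm.
  have : unorm NU T (fun t => v t - uh t) <= L * unorm NU T (fun t => v t - uh
    t).
    apply: le_trans (S_uh v av); apply: unorm_le => // s sT;
      rewrite -(vfix s sT).
    exact: (le_unorm_admissible NU T hN U _ _ s cU (S_adm _ av) uh_adm sT).
  by move=> h2; have := L1; nra.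
- move=> u au; set a := (X in X @ _ --> _).
  apply: (@squeeze_cvgr _ _ _ _ (fun=> 0)
    (fun n => unorm NU T (fun t => u t - uh t) * L ^+ n)).
  + near=> n; apply/andP; split; last exact: iter_uh.
    by apply: unorm_admissible_ge0 => //;
      [exact: cU|exact: iter_adm|exact: uh_adm].
  + exact: cvg_cst.
  + rewrite -[X in _ --> X](mulr0 (unorm NU T (fun t => u t - uh t))).
    by apply: cvgMl_tmp; apply: cvg_expr; rewrite ger0_norm//; case/andP: L01.
- move=> u au i t tT.
  apply: le_trans (le_unorm_admissible NU T hN U _ _ t cU (iter_adm _ _ au)
    uh_adm tT) _.
  apply: le_trans (iter_uh u i au) _.
  rewrite mulrC -mulrA; apply: ler_wpM2l; first exact: exprn_ge0.
  rewrite mulrC ler_pdivlMr// mulrBr mulr1 lerBlDr.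
  (* With [d] the initial distance to [uh], solving [d <= unorm NU T (S u - u) + L * d] for [d]
     yields the factor [1 / (1 - L)]. *)
  have h1 : unorm NU T (fun t => u t - uh t) <=
      unorm NU T (fun t => S u t - u t) + unorm NU T (fun t => S u t - uh t).
    apply: unorm_le => // s sT.
    have -> : u s - uh s = - (S u s - u s) + (S u s - uh s).
      by rewrite opprB addrA subrK.
    apply: le_trans (NT _ _) _; rewrite (is_normN _ hN); apply: lerD.
      exact: (le_unorm_admissible NU T hN U _ _ s cU (S_adm _ au) au sT).
    exact: (le_unorm_admissible NU T hN U _ _ s cU (S_adm _ au) uh_adm sT).
  by apply: le_trans h1 _; rewrite lerD2l mulrC; exact: S_uh.
Unshelve. all: by end_near. Qed.

End fixed_point.

(** * The MSA operator *)

(** The set [X] is only bounded. A closed ball containing it is compact, which makes the Jacobians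
    over the tube a compact family, and convex, which keeps the segments of the mean value
    inequality inside. *)
Lemma compact_tube {R : realType} {n k} (T r : R) (U : set 'cV[R]_k) :
  compact U ->
  compact (`[0, T]%classic `*` [set x : 'cV[R]_n | `|x| <= r] `*` U).
Proof.
move=> cU; apply: compact_setX => //; apply: compact_setX.
  exact: segment_compact.
apply: cV_bounded_closed_compact.
  exists r; split; first exact: num_real.
  by move=> M rM x /= /le_trans; apply; exact: ltW.
rewrite (_ : mkset _ = Num.norm @^-1` [set y | y <= r])//.
by apply: preimage_closed => // x _; exact: norm_continuous.
Qed.

Lemma subset_tube {R : realType} {n k} (T r : R) (U : set 'cV[R]_k) :
  `[0, T]%classic `*` [set x : 'cV[R]_n | `|x| <= r] `*` U `<=`
  `[0, T]%classic `*` setT `*` U.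
Proof. by move=> p [[? _] ?]; split. Qed.

Lemma field_bounded_tube {R : realType} {n k} (N : 'cV[R]_n -> R) (T r : R)
    (U : set 'cV[R]_k) (f : R -> 'cV[R]_n -> 'cV[R]_k -> 'cV[R]_n) :
  is_norm N -> compact U ->
  {within `[0, T] `*` setT `*` U, continuous (fun p => f p.1.1 p.1.2 p.2)} ->
  exists M, forall s z w, 0 <= s <= T -> `|z| <= r -> U w -> N (f s z w) <= M.
Proof.
move=> hN cU cf; have [C C0 NC] := is_norm_le hN.
have cfK := continuous_subspaceW (subset_tube T r U) cf.
have [M M0 hM] := bounded_set_le _
  (compact_bounded (continuous_compact cfK (compact_tube T r U cU))).
exists (C * M) => s z w sT zr Uw; apply: le_trans (NC _) _.
rewrite ler_pM2l//; apply: hM; exists (s, z, w) => //=.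
Qed.

Lemma jac_step_tube {R : realType} {n k} (N : 'cV[R]_n -> R) (T c r : R)
    (U : set 'cV[R]_k) (f : R -> 'cV[R]_n -> 'cV[R]_k -> 'cV[R]_n) :
  is_norm N -> compact U ->
  {within `[0, T] `*` setT `*` U,
     continuous (fun p => jac (fun y => f p.1.1 y p.2) p.1.2)} ->
  (forall t u, 0 <= t <= T -> U u -> osl_le N (fun y => f t y u) (- c)) ->
  forall e, 0 < e -> exists2 d, 0 < d & forall s h x u w,
    0 <= s <= T -> 0 < h <= d -> `|x| <= r -> U u ->
    N (w + h *: (jac (fun y => f s y u) x *m w)) <= (1 + h * (- c + e)) * N w.
Proof.
move=> hN cU cJ osl e e0.
have cJK := continuous_subspaceW (subset_tube T r U) cJ.
have cA := continuous_compact cJK (compact_tube T r U cU).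
have [|d d0 hd] := lognorm_le_step_compact _ (- c) e hN cA _ e0.
  by move=> _ [[[s x] u] /= [[sT _] Uu] <-]; apply: osl => //; move: sT;
    rewrite /= in_itv.
exists d => // s h x u w sT hh xr Uu; apply: hd => //.
exists (s, x, u) => //=.
Qed.

Lemma field_step_tube {R : realType} {n k} (N : 'cV[R]_n -> R) (T c r : R)
    (U : set 'cV[R]_k) (f : R -> 'cV[R]_n -> 'cV[R]_k -> 'cV[R]_n) :
  is_norm N ->
  (forall t x u, 0 <= t <= T -> U u -> differentiable (fun y => f t y u) x) ->
  (forall e, 0 < e -> exists2 d, 0 < d & forall s h x u w,
    0 <= s <= T -> 0 < h <= d -> `|x| <= r -> U u ->
    N (w + h *: (jac (fun y => f s y u) x *m w)) <= (1 + h * (- c + e)) * N w)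
      ->
  forall e, 0 < e -> exists2 d, 0 < d & forall s h x y u,
    0 <= s <= T -> 0 < h <= d -> `|x| <= r -> `|y| <= r -> U u ->
    N ((x - y) + h *: (f s x u - f s y u)) <= (1 + h * (- c + e)) * N (x - y).
Proof.
move=> hN df J_step e e0; have [d d0 hd] := J_step e e0.
exists d => // s h x y u sT hh xr yr Uu.
apply: (mean_value_step (fun y => f s y u)) => // [z|t w /andP[t0 t1]].
  exact: df.
apply: hd => //.
have -> : y + t *: (x - y) = (1 - t) *: y + t *: x.
  by apply/colP => i; rewrite !mxE; ring.
apply: le_trans (ler_normD _ _) _.
rewrite !normrZ !ger0_norm ?subr_ge0//.
have t1' : 0 <= 1 - t by rewrite subr_ge0.
have := ler_wpM2l t0 xr; have := ler_wpM2l t1' yr; lra.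
Qed.

Lemma dualnormD {R : realType} {n} {N : 'cV[R]_n -> R} x y : is_norm N ->
  dualnorm N (x + y) <= dualnorm N x + dualnorm N y.
Proof.
move=> hN; apply: dualnorm_le => // z z1; rewrite vdotDr.
by apply: lerD; exact: vdot_le_dualnorm1.
Qed.

(** The Lipschitz assumptions vary the state or the control, one at a time and at a fixed costate.
    The index 2 stands for the hybrid point, with the state of the second trajectory and the control
    of the first. *)
Lemma dualnorm_forcing_le {R : realType} {n} {N : 'cV[R]_n -> R}
    (A1 A2 A3 : 'M[R]_n) (l1 l3 g1 g2 g3 : 'cV[R]_n) r1 r2 r3 r4 : is_norm N ->
  dualnorm N (A1 *m l1 - A2 *m l1) <= r1 ->
  dualnorm N (A2 *m l1 - A3 *m l1) <= r2 ->
  dualnorm N (g1 - g2) <= r3 -> dualnorm N (g2 - g3) <= r4 ->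
  dualnorm N ((A1 *m l1 + g1) - (A3 *m l3 + g3) - A3 *m (l1 - l3)) <=
    r1 + r2 + (r3 + r4).
Proof.
move=> hN h1 h2 h3 h4.
have -> : (A1 *m l1 + g1) - (A3 *m l3 + g3) - A3 *m (l1 - l3) =
    (A1 *m l1 - A2 *m l1) + (A2 *m l1 - A3 *m l1) + ((g1 - g2) + (g2 - g3)).
  rewrite mulmxBr.
  move: (A1 *m l1) (A2 *m l1) (A3 *m l1) (A3 *m l3) => m1 m2 m3 m4.
  by apply/colP => i; rewrite !mxE; ring.
apply: le_trans (dualnormD _ _ hN) _.
by apply: lerD; (apply: le_trans (dualnormD _ _ hN) _; exact: lerD).
Qed.

Theorem theorem5 (R : realType) (n k : nat) (T : R) (U : set 'cV[R]_k)
  (f : R -> 'cV[R]_n -> 'cV[R]_k -> 'cV[R]_n) (x0 : 'cV[R]_n)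
  (phi : R -> 'cV[R]_n -> 'cV[R]_k -> R) (psi : 'cV[R]_n -> R)
  (xs lam : (R -> 'cV[R]_k) -> R -> 'cV[R]_n)
  (X Lam : set 'cV[R]_n)
  (N : 'cV[R]_n -> R) (NU : 'cV[R]_k -> R)
  (h : R -> 'cV[R]_n -> 'cV[R]_n -> 'cV[R]_k)
  (c l_fu l_fxx l_fxu l_phxx l_phxu l_psxx l_hx l_hl : R) :
  (* problem data *)
  0 < T ->
  compact U -> U 0 ->
  {within `[0, T] `*` setT `*` U, continuous (fun p => f p.1.1 p.1.2 p.2)} ->
  (forall t x u, 0 <= t <= T -> U u -> differentiable (fun y => f t y u) x) ->
  {within `[0, T] `*` setT `*` U,
     continuous (fun p => jac (fun y => f p.1.1 y p.2) p.1.2)} ->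
  (forall t x u, 0 <= t <= T -> U u -> differentiable (fun v => f t x v) u) ->
  {within `[0, T] `*` setT `*` U,
     continuous (fun p => jac (fun v => f p.1.1 p.1.2 v) p.2)} ->
  (forall t x u, 0 <= t <= T -> U u -> differentiable (fun y => phi t y u) x) ->
  (forall x, differentiable psi x) ->
  (* state and costate solutions (assumed to exist) *)
  (forall u, admissible U T u -> is_state f x0 T u (xs u)) ->
  (forall u, admissible U T u -> is_costate f phi psi T u (xs u) (lam u)) ->
  (* bounded sets X, Lambda containing all states / costates *)
  bounded_set X -> bounded_set Lam ->
  (forall u, admissible U T u -> forall t, 0 <= t <= T ->
     X (xs u t) /\ Lam (lam u t)) ->
  (* norms *)
  is_norm N -> is_norm NU ->
  (* Lipschitz constants are nonnegative *)
  0 <= l_fu -> 0 <= l_fxx -> 0 <= l_fxu -> 0 <= l_phxx -> 0 <= l_phxu ->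
  0 <= l_psxx -> 0 <= l_hx -> 0 <= l_hl ->
  (* (A1) *)
  0 < c ->
  (forall t u, 0 <= t <= T -> U u -> osl_le N (fun y => f t y u) (- c)) ->
  (exists M, forall t, 0 <= t <= T -> N (xs (fun=> 0) t) <= M) ->
  (* (A2) *)
  (forall t x, 0 <= t <= T -> lip_with NU N U (fun v => f t x v) l_fu) ->
  (* (A3) *)
  (forall t xt ut lt, 0 <= t <= T -> X xt -> U ut -> Lam lt ->
     lip_with N (dualnorm N) setT
       (fun y => (jac (fun z => f t z ut) y)^T *m lt) l_fxx /\
     lip_with NU (dualnorm N) U
       (fun v => (jac (fun z => f t z v) xt)^T *m lt) l_fxu) ->
  (* (A4) *)
  (forall t xt ut, 0 <= t <= T -> X xt -> U ut ->
     lip_with N (dualnorm N) setT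
       (fun y => grad (fun z => phi t z ut) y) l_phxx /\
     lip_with NU (dualnorm N) U
       (fun v => grad (fun z => phi t z v) xt) l_phxu) ->
  lip_with N (dualnorm N) setT (grad psi) l_psxx ->
  (* (A5) : h is a selection of the argmin of H, defining MSA *)
  (forall t x l, 0 <= t <= T -> X x -> Lam l ->
     U (h t x l) /\ forall v, U v -> Ham f phi t x l (h t x l) <= Ham f phi t x l v) ->
  (forall t xt lt, 0 <= t <= T -> X xt -> Lam lt ->
     lip_with N NU X (fun y => h t y lt) l_hx /\
     lip_with (dualnorm N) NU Lam (fun m => h t xt m) l_hl) ->
  (* MSA maps admissible controls to admissible controls *)
  (forall u, admissible U T u -> admissible U T (MSA h xs lam u)) ->
  let kappa := c^-1 * (1 - expR (- (c * T))) in
  let b1 := l_hx * l_fu + l_hl * (l_psxx * l_fu + l_phxu + l_fxu) in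
  let b2 := l_hl * l_fu * (l_phxx + l_fxx) in
  let L := b1 * kappa + b2 * kappa ^+ 2 in
  let S := MSA h xs lam in
  (* (i) Lip(MSA) <= L *)
  (forall u v, admissible U T u -> admissible U T v ->
     unorm NU T (fun t => S u t - S v t) <= L * unorm NU T (fun t => u t - v t)) /\
  (* (ii) *)
  (L < 1 ->
    (exists q, 0 <= q < 1 /\
       forall u v, admissible U T u -> admissible U T v ->
         unorm NU T (fun t => S u t - S v t) <= q * unorm NU T (fun t => u t - v t)) /\
    exists uh, admissible U T uh /\
      (forall t, 0 <= t <= T -> S uh t = uh t) /\
      (forall v, admissible U T v -> (forall t, 0 <= t <= T -> S v t = v t) ->
         forall t, 0 <= t <= T -> v t = uh t) /\
      (forall u0, admissible U T u0 ->
         (fun i : nat => unorm NU T (fun t => iter i S u0 t - uh t)) @ \oo --> 0) /\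
      (forall u0, admissible U T u0 -> forall (i : nat) t, 0 <= t <= T ->
         NU (iter i S u0 t - uh t)
           <= L ^+ i / (1 - L) * unorm NU T (fun t => S u0 t - u0 t))).
Proof.
move=> T0 cU U0 cf dfx cJ _ _ _ _ state costate bX bLam inXL hN hNU.
move=> lfu0 lfxx0 lfxu0 lphxx0 lphxu0 lpsxx0 lhx0 lhl0 c0 osl _ A2 A3 A4 A4psi
  _ A5 MSA_adm.
move=> kappa b1 b2 L S.
have kappa0 : 0 <= kappa.
  rewrite mulr_ge0 ?invr_ge0 ?(ltW c0)// subr_ge0 -expR0 ler_expR oppr_le0.
  by rewrite mulr_ge0 ?(ltW c0) ?(ltW T0).
have b10 : 0 <= b1 by rewrite !(addr_ge0, mulr_ge0).
have b20 : 0 <= b2 by rewrite !(addr_ge0, mulr_ge0).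
have L0 : 0 <= L by rewrite addr_ge0// mulr_ge0// exprn_ge0.
have [r r0 Xr] := bounded_set_le X bX.
have J_step := jac_step_tube N T c r U f hN cU cJ osl.
have f_step := field_step_tube N T c r U f hN dfx J_step.
have [M fM] := field_bounded_tube N T r U f hN cU cf.
have TT : 0 <= T <= T by rewrite lexx ltW.
have S_lip u v : admissible U T u -> admissible U T v ->
    unorm NU T (fun t => S u t - S v t) <= L * unorm NU T (fun t => u t - v t).
  move=> au av; set Delta := unorm NU T (fun t => u t - v t).
  have D0 : 0 <= Delta by exact: (unorm_admissible_ge0 NU T hNU T0 U _ _ cU au
    av).
  have uvD s : 0 <= s <= T -> NU (u s - v s) <= Delta.
    exact: (le_unorm_admissible NU T hNU U _ _ s cU au av).
  have [Uu _] := au; have [Uv _] := av.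
  have xyE t : 0 <= t <= T -> N (xs u t - xs v t) <= l_fu * Delta * kappa.
    apply: (state_estimate N T c f U [set x | `|x| <= r] hN T0 c0 f_step x0 M
      (l_fu * Delta) u v) => [s|s sT|s sT||].
    - exact: fM.
    - by split; [exact: Uu|exact: Uv|apply: Xr; exact: (inXL u au s sT).1
        |apply: Xr; exact: (inXL v av s sT).1].
    - apply: le_trans (A2 s _ sT _ _ (Uu s sT) (Uv s sT)) _.
      by rewrite ler_wpM2l ?uvD.
    - exact: state.
    - exact: state.
  have lamE t : 0 <= t <= T -> dualnorm N (lam u t - lam v t) <=
      l_psxx * (l_fu * Delta * kappa) +
      ((l_fxx + l_phxx) * (l_fu * Delta * kappa) + (l_fxu + l_phxu) * Delta) *
        kappa.
    move=> tT.
    have [gu lu] := costate u au; have [gv lv] := costate v av.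
    have [Cd Cd0 dC] := dualnorm_le_mx_norm hN.
    have [rL rL0 Lr] := bounded_set_le Lam bLam.
    set Gu := fun s => _ in gu lu; set Gv := fun s => _ in gv lv.
    (* The coefficient is the Jacobian along the trajectory of [v]; the Jacobian difference acting
       on [lam u] and the difference of the gradients of [phi] are then forcing. Boundedness of
       [Lam] supplies the a priori bound. *)
    apply: le_trans (costate_estimate N T c
      ((l_fxx + l_phxx) * (l_fu * Delta * kappa) + (l_fxu + l_phxu) * Delta)
      (Cd * (rL + rL))
      (fun s => jac (fun y => f s y (v s)) (xs v s))
      (fun s => Gu s - Gv s) (fun s => lam u s - lam v s)
      (grad psi (xs u T) - grad psi (xs v T)) hN T0 c0 _ _ _ _ _ t tT) _.
    - move=> e e0; have [d d0 hd] := J_step e e0; exists d => // s h' y sT hh.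
      apply: hd => //; last exact: Uv.
      by apply: Xr; exact: (inXL v av s sT).1.
    - exact: vintegrableB.
    - move=> s /andP[s0 sT]; rewrite lu ?s0// lv ?s0// vintB.
      + by rewrite opprD addrACA.
      + exact: vintegrableS gu _ _.
      + exact: vintegrableS gv _ _.
    - move=> s sT.
      have [Xu Lu] := inXL u au s sT; have [Xv Lv] := inXL v av s sT.
      have [a3x _] := A3 s _ _ _ sT Xu (Uu s sT) Lu.
      have [_ a3u] := A3 s _ _ _ sT Xv (Uu s sT) Lu.
      have [a4x _] := A4 s _ _ sT Xu (Uu s sT).
      have [_ a4u] := A4 s _ _ sT Xv (Uu s sT).
      have {}a3x := a3x (xs u s) (xs v s) I I.
      have {}a4x := a4x (xs u s) (xs v s) I I.
      have {}a3u := a3u _ _ (Uu s sT) (Uv s sT).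
      have {}a4u := a4u _ _ (Uu s sT) (Uv s sT).
      apply: le_trans (dualnorm_forcing_le _ _ _ _ _ _ _ _ _ _ _ _ hN
        a3x a3u a4x a4u) _.
      have k1 := ler_wpM2l lfxx0 (xyE s sT).
      have k2 := ler_wpM2l lphxx0 (xyE s sT).
      have k3 := ler_wpM2l lfxu0 (uvD s sT).
      have k4 := ler_wpM2l lphxu0 (uvD s sT).
      apply: le_trans (lerD (lerD k1 k3) (lerD k2 k4)) _.
      by rewrite addrACA -!mulrDl.
    - move=> s sT; apply: le_trans (dC _) _; rewrite ler_pM2l//.
      apply: le_trans (ler_normB _ _) _.
      by apply: lerD; apply: Lr;
        [exact: (inXL u au s sT).2|exact: (inXL v av s sT).2].
    - rewrite lerD2r lu// lv// !vint_point !addr0.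
      apply: le_trans (A4psi _ _ I I) _.
      by rewrite ler_wpM2l ?xyE.
  apply: unorm_le => // t tT.
  have [Xu Lu] := inXL u au t tT; have [Xv Lv] := inXL v av t tT.
  have [hx _] := A5 t _ _ tT Xu Lu.
  have [_ hl] := A5 t _ _ tT Xv Lu.
  have {}hx := hx _ _ Xu Xv; have {}hl := hl _ _ Lu Lv.
  (* The intermediate point pairs the state of [v] with the costate of [u], since [A5] varies one
     argument at a time. *)
  have -> : S u t - S v t = (h t (xs u t) (lam u t) - h t (xs v t) (lam u t)) +
      (h t (xs v t) (lam u t) - h t (xs v t) (lam v t)).
    by rewrite addrA subrK.
  have [_ _ _ NUT] := hNU; apply: le_trans (NUT _ _) _.
  have k1 := ler_wpM2l lhx0 (xyE t tT).
  have k2 := ler_wpM2l lhl0 (lamE t tT).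
  have -> : L * Delta = l_hx * (l_fu * Delta * kappa) + l_hl *
      (l_psxx * (l_fu * Delta * kappa) +
      ((l_fxx + l_phxx) * (l_fu * Delta * kappa) + (l_fxu + l_phxu) * Delta) *
        kappa).
    by rewrite /L /b1 /b2; ring.
  by apply: lerD; [exact: le_trans hx k1|exact: le_trans hl k2].
split => // L1; split.
  by exists L; rewrite L0 L1; split.
apply: (admissible_fixed_point NU T L U S) => //.
by rewrite L0.
Qed.
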